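(* Let $K_0\in\mathbb{K}$, suppose $J(K_0)=\alpha$, $\mu>0$ and $B\neq0$, and define $$\zeta_1 = \frac{1}{\sigma_{\min}(Q)}\Big((1+\|C\|^2\|B\|^2)\frac{\alpha}{\mu}+\|C\|^2\|R\|\Big)-1,$$ $$L=2\|C\|^2\Big(\|R\|+\|B\|^2\Big(1+\frac{2\zeta_1}{\|C\|\|B\|}\Big)\frac{\alpha}{\mu}\Big)\frac{\alpha}{\sigma_{\min}(Q)}.$$ Consider gradient descent $K_{i+1}=K_i-\eta\nabla J(K_i)$, $i=0,1,2,\dots$, with any step size $0<\eta\le 1/L$. Then: (1) all iterates lie in $\mathbb{K}$ and $J(K_i)$ is monotone decreasing, i.e. $J(K_{i+1})\le J(K_i)$ for all $i$; (2) for every $\epsilon>0$, the algorithm outputs an $\epsilon$-first-order stationary point within $\frac{2\alpha}{\eta\epsilon^2}$ iterations, i.e. there is an index $i\le \frac{2\alpha}{\eta\epsilon^2}$ with $\|\nabla J(K_i)\|_F\le\epsilon$; (3) for every $i\in\mathbb{N}$, the line segment between $K_i$ and $K_{i+1}$ is contained in $\mathbb{K}_\alpha$; (4) if moreover $C\in\mathbb{R}^{n\times n}$ with $\mathrm{rank}(C)=n$, then for every $\epsilon_J>0$ the iterate $K_N$ satisfies $J(K_N)-J_s^*\le\epsilon_J$ whenever $$N\ge\frac{\|\Sigma_{K^*}\|}{2\eta\mu^2\sigma_{\min}(C)^2\sigma_{\min}(R)}\log\Big(\frac{J(K_0)-J_s^*}{\epsilon_J}\Big).$$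
   Context: Setting: $A\in\mathbb{R}^{n\times n}$, $B\in\mathbb{R}^{n\times m}$, $C\in\mathbb{R}^{d\times n}$ with $C$ of full row rank; $Q\in\mathbb{R}^{n\times n}$ and $R\in\mathbb{R}^{m\times m}$ are symmetric positive definite. The system is $x_{t+1}=Ax_t+Bu_t$, $y_t=Cx_t$, with static output feedback $u_t=-Ky_t$, $K\in\mathbb{R}^{m\times d}$, so that $x_{t+1}=(A-BKC)x_t$. The initial state $x_0$ is drawn from a distribution $\mathcal{D}$ with second-moment matrix $X_0:=\mathbb{E}_{x_0\sim\mathcal{D}}[x_0x_0^\top]\in\mathbb{R}^{n\times n}$, and $\mu:=\sigma_{\min}(X_0)$ is the minimal singular value of $X_0$. The feasible set is $\mathbb{K}=\{K\in\mathbb{R}^{m\times d}:\rho(A-BKC)<1\}$ ($\rho$ = spectral radius), assumed nonempty. For $K\in\mathbb{K}$ the cost is $J(K)=\mathbb{E}_{x_0\sim\mathcal{D}}\big[\sum_{t=0}^\infty x_t^\top(Q+C^\top K^\top RKC)x_t\big]$. Equivalently $J(K)=\mathrm{Tr}(P_KX_0)$, where $P_K$ is the solution of $P_K=Q+C^\top K^\top RKC+(A-BKC)^\top P_K(A-BKC)$. The state correlation matrix is $\Sigma_K:=\mathbb{E}_{x_0\sim\mathcal{D}}\sum_{t=0}^\infty x_tx_t^\top$, which satisfies $\Sigma_K=X_0+(A-BKC)\Sigma_K(A-BKC)^\top$. $K^*$ is a global minimizer of $J$ over $\mathbb{K}$; $\mathbb{K}_\alpha=\{K\in\mathbb{K}:J(K)\le\alpha\}$.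 $J_s^*$ is the optimal cost of the corresponding state feedback LQR problem, i.e. the minimum over $F\in\mathbb{R}^{m\times n}$ with $\rho(A-BF)<1$ of $\mathbb{E}_{x_0\sim\mathcal{D}}\sum_{t=0}^\infty x_t^\top(Q+F^\top RF)x_t$ with $x_{t+1}=(A-BF)x_t$. $\|\cdot\|$ is the spectral norm, $\|\cdot\|_F$ the Frobenius norm, $\sigma_{\min}$ the minimal singular value. $\nabla J(K)\in\mathbb{R}^{m\times d}$ is the gradient with respect to the Frobenius inner product. $K$ is an $\epsilon$-first-order stationary point if $\|\nabla J(K)\|_F\le\epsilon$. *)

(* Defs.v *)
From HB Require Import structures.
From mathcomp Require Import all_boot all_order all_algebra.
From mathcomp Require Import all_classical all_reals all_analysis.
From mathcomp Require Import complex.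

Set Implicit Arguments.
Unset Strict Implicit.
Unset Printing Implicit Defensive.

Import Order.TTheory GRing.Theory Num.Theory.
Import numFieldNormedType.Exports.

Local Open Scope classical_set_scope.
Local Open Scope ring_scope.

Section MatrixQuantities.
Context {R : realType}.

(* On a column vector this is the Euclidean norm. *)
Definition frobenius_norm p q (M : 'M[R]_(p, q)) : R :=
  Num.sqrt (\sum_i \sum_j M i j ^+ 2).

(* The operator norm induced by the Euclidean norms.  The norm `|M| which the
   library puts on matrices is the max norm. *)
Definition spectral_norm p q (M : 'M[R]_(p, q)) : R :=
  sup [set frobenius_norm (M *m x) | x in
        [set x : 'cV[R]_q | frobenius_norm x <= 1]].

(* The smaller of the two Gram matrices is used, so that a p x q matrix has
   min(p, q) singular values, and not additional zeros. *)
Definition singular_value p q (M : 'M[R]_(p, q)) (s : R) : Prop :=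
  0 <= s /\
  (if (q <= p)%N then eigenvalue (M^T *m M) (s ^+ 2)
   else eigenvalue (M *m M^T) (s ^+ 2)).

Definition sigma_min p q (M : 'M[R]_(p, q)) : R :=
  inf [set s | singular_value M s].

Definition spectral_radius n (M : 'M[R]_n) : R :=
  sup [set ComplexField.Normc.normc z | z in
        [set z : R[i] | eigenvalue (map_mx (real_complex R) M) z]].

Definition sym_posdef n (M : 'M[R]_n) : Prop :=
  M^T = M /\ forall x : 'cV[R]_n, x != 0 -> 0 < (x^T *m M *m x) 0 0.

(* The matrix representing the differential of f at K for the Frobenius inner
   product, see tr_gradient. *)
Definition gradient p q (f : 'M[R]_(p, q) -> R) (K : 'M[R]_(p, q)) :
    'M[R]_(p, q) :=
  \matrix_(i, j) 'd f K (delta_mx i j).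

Lemma tr_gradient p q (f : 'M[R]_(p, q) -> R) (K H : 'M[R]_(p, q)) :
  \tr ((gradient f K)^T *m H) = 'd f K H.
Proof.
rewrite [in RHS](matrix_sum_delta H) linear_sum /mxtrace.
under eq_bigr do rewrite mxE.
rewrite exchange_big; apply: eq_bigr => i _.
rewrite linear_sum; apply: eq_bigr => j _.
by rewrite linearZ !mxE mulrC.
Qed.

End MatrixQuantities.

Section LQR.
Context {R : realType} {dsp : measure_display} {T : measurableType dsp}.
Variables (P : probability T R) (n m d : nat).
Variable x0 : 'I_n -> {RV P >-> R}.

Definition initial_state (w : T) : 'cV[R]_n := \col_i x0 i w.

Definition second_moment : 'M[R]_n :=
  \matrix_(i, j) fine 'E_P[fun w => (initial_state w *m (initial_state w)^T) i j].

Definition state (M : 'M[R]_n) (w : T) (t : nat) : 'cV[R]_n :=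
  iter t (mulmx M) (initial_state w).

(* E [sum_t x_t^T W x_t] along x_{t+1} = M x_t.  For W positive semidefinite
   the extended-real sum and integral are always meaningful; fine is harmless
   when the spectral radius of M is < 1 and x_0 has finite second moments. *)
Definition quadratic_cost (M W : 'M[R]_n) : R :=
  fine (\int[P]_w
    (\sum_(0 <= t <oo) (((state M w t)^T *m W *m state M w t) 0 0)%:E)%E).

Variables (A : 'M[R]_n) (B : 'M[R]_(n, m)) (C : 'M[R]_(d, n)).
Variables (Q : 'M[R]_n) (Rw : 'M[R]_m).

Definition feasible (K : 'M[R]_(m, d)) : Prop :=
  spectral_radius (A - B *m K *m C) < 1.

Definition output_cost (K : 'M[R]_(m, d)) : R :=
  quadratic_cost (A - B *m K *m C) (Q + C^T *m K^T *m Rw *m K *m C).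

Definition sublevel (alpha : R) (K : 'M[R]_(m, d)) : Prop :=
  feasible K /\ output_cost K <= alpha.

Definition global_minimizer (K : 'M[R]_(m, d)) : Prop :=
  feasible K /\ forall K', feasible K' -> output_cost K <= output_cost K'.

Definition state_correlation (K : 'M[R]_(m, d)) : 'M[R]_n :=
  let M := A - B *m K *m C in
  \matrix_(i, j) fine (\int[P]_w
    (\sum_(0 <= t <oo) ((state M w t *m (state M w t)^T) i j)%:E)%E).

Definition state_feedback_cost (F : 'M[R]_(m, n)) : R :=
  quadratic_cost (A - B *m F) (Q + F^T *m Rw *m F).

Definition optimal_state_feedback_cost : R :=
  inf [set state_feedback_cost F | F in
        [set F : 'M[R]_(m, n) | spectral_radius (A - B *m F) < 1]].

Definition gradient_descent (eta : R) (K0 : 'M[R]_(m, d)) (i : nat) :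
    'M[R]_(m, d) :=
  iter i (fun K => K - eta *: gradient output_cost K) K0.

End LQR.

(* Main.v *)
Require Import Defs.
From HB Require Import structures.
From mathcomp Require Import all_boot all_order all_algebra.
From mathcomp Require Import all_classical all_reals all_analysis.
From mathcomp Require Import measurable_realfun complex ring lra.

(** Gradient descent for the static output feedback LQR problem.

    For a stabilizing gain K put M = A - B K C and W = Q + C^T K^T R K C. The
    Lyapunov equations V = W + M^T V M and S = X0 + M S M^T have positive
    semidefinite solutions, and J K = tr (V X0) = tr (W S) (quadratic_costE,
    lyapunov_duality). A spectral radius below 1 enters through the decay of
    trajectories (spectral_radius_lt1_stable), and conversely a decreasing
    quadratic form forces it (lyapunov_spectral_radius_lt1).

    The crucial point is that J is L-smooth on the sublevel set of alpha. For
    another gain K + E with correlation matrix S' the cost difference is exactly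
    tr (H S') + tr (F S'), where H and F are linear and quadratic in E
    (cost_difference), and tr (H S) is the inner product of E with the gradient
    2 (R K C - B^T V M) S C^T. The solution Y of Y = H + M^T Y M, which is the
    derivative of V, satisfies - zeta_1 |E| V <= Y <= zeta_1 |E| V by Young's
    inequality and the comparison of Lyapunov equations (first_order_corrector).
    Duality then rewrites tr (H (S' - S)) as a trace against S' that contains the
    factor B E C twice, once directly and once through Y. Together with
    V <= alpha / mu and tr S' <= J (K + E) / sigma_min Q this gives
    J (K + E) = J K + <grad J K, E> up to L / 2 |E|^2 plus a cubic term, for
    |E| below a radius that is uniform on the sublevel set (sublevel_expansion).

    The cubic term disappears by subdividing the segment from K to K + D into
    small steps (segment_descent): if <grad J K, D> <= - L |D|^2, the segment
    never leaves the sublevel set and J (K + D) <= J K + <grad J K, D> +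
    L / 2 |D|^2 (descent_step). With D a fraction of a gradient step this gives
    feasibility and monotonicity of the iterates, containment of the segments,
    and the decrease eta / 2 |grad J|^2 per step. Summing the decrease yields the
    iteration bound for stationarity (small_gradient_index).

    For invertible C, completing the square in the cost difference between a
    minimizer and K bounds J K - J Kstar by a multiple of |grad J K|^2
    (gradient_dominance); with the decrease per step this contracts the cost gap
    geometrically (linear_rate). The minimum over output feedbacks then equals
    the optimal state feedback cost, because every F is (F C^-1) C. *)

Set Implicit Arguments.
Unset Strict Implicit.
Unset Printing Implicit Defensive.

Import Order.TTheory GRing.Theory Num.Theory.
Import numFieldNormedType.Exports.

Local Open Scope classical_set_scope.
Local Open Scope ring_scope.

(** * The Frobenius inner product and quadratic forms *)

Section QuadraticForms.
Context {R : realFieldType}.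

Definition inner p q (U V : 'M[R]_(p, q)) : R := \tr (U^T *m V).

Definition qform n q (S : 'M[R]_n) (X : 'M[R]_(n, q)) : R := inner X (S *m X).

Definition psd n (S : 'M[R]_n) : Prop :=
  S^T = S /\ forall x : 'cV[R]_n, 0 <= qform S x.

Lemma innerE p q (U V : 'M[R]_(p, q)) :
  inner U V = \sum_i \sum_j U i j * V i j.
Proof.
rewrite /inner /mxtrace exchange_big; apply: eq_bigr => j _.
by rewrite mxE; apply: eq_bigr => i _; rewrite mxE.
Qed.

Lemma inner_sym p q (U V : 'M[R]_(p, q)) : inner U V = inner V U.
Proof. by rewrite /inner -mxtrace_tr trmx_mul trmxK. Qed.

Lemma innerDl p q (U V W : 'M[R]_(p, q)) :
  inner (U + V) W = inner U W + inner V W.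
Proof. by rewrite /inner linearD mulmxDl linearD. Qed.

Lemma innerDr p q (U V W : 'M[R]_(p, q)) :
  inner W (U + V) = inner W U + inner W V.
Proof. by rewrite /inner mulmxDr linearD. Qed.

Lemma innerZl p q a (U V : 'M[R]_(p, q)) : inner (a *: U) V = a * inner U V.
Proof. by rewrite /inner linearZ -scalemxAl linearZ. Qed.

Lemma innerZr p q a (U V : 'M[R]_(p, q)) : inner U (a *: V) = a * inner U V.
Proof. by rewrite /inner -scalemxAr linearZ. Qed.

Lemma innerNr p q (U V : 'M[R]_(p, q)) : inner U (- V) = - inner U V.
Proof. by rewrite -scaleN1r innerZr mulN1r. Qed.

Lemma innerBr p q (U V W : 'M[R]_(p, q)) :
  inner W (U - V) = inner W U - inner W V.
Proof. by rewrite innerDr innerNr. Qed.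

Lemma inner0r p q (U : 'M[R]_(p, q)) : inner U 0 = 0.
Proof. by rewrite /inner mulmx0 mxtrace0. Qed.

Lemma inner_mull p q r (A : 'M[R]_(p, r)) (U : 'M[R]_(r, q)) V :
  inner (A *m U) V = inner U (A^T *m V).
Proof. by rewrite /inner trmx_mul mulmxA. Qed.

Lemma inner_tr p q (U V : 'M[R]_(p, q)) : inner U^T V^T = inner U V.
Proof. by rewrite inner_sym /inner trmxK mxtrace_mulC. Qed.

Lemma inner_ge0 p q (U : 'M[R]_(p, q)) : 0 <= inner U U.
Proof.
by rewrite innerE; apply: sumr_ge0 => i _; apply: sumr_ge0 => j _; rewrite -expr2 sqr_ge0.
Qed.

Lemma inner_eq0 p q (U : 'M[R]_(p, q)) : (inner U U == 0) = (U == 0).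
Proof.
apply/eqP/eqP => [|->]; last by rewrite inner0r.
rewrite innerE => /psumr_eq0P H; apply/matrixP => i j; rewrite mxE.
have /psumr_eq0P H' := H (fun i _ => sumr_ge0 _ (fun j _ => sqr_ge0 _)) i isT.
by have /eqP := H' (fun j _ => sqr_ge0 _) j isT; rewrite mulf_eq0 orbb => /eqP.
Qed.

Lemma inner_gt0 p q (U : 'M[R]_(p, q)) : (0 < inner U U) = (U != 0).
Proof. by rewrite lt_def inner_ge0 andbT inner_eq0. Qed.

Lemma inner_col p q (U V : 'M[R]_(p, q)) :
  inner U V = \sum_k inner (col k U) (col k V).
Proof.
rewrite innerE exchange_big; apply: eq_bigr => k _.
by rewrite innerE; apply: eq_bigr => i _; rewrite big_ord1 !mxE.
Qed.

Lemma qform_col n q (S : 'M[R]_n) (X : 'M[R]_(n, q)) :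
  qform S X = \sum_k qform S (col k X).
Proof.
by rewrite /qform inner_col; apply: eq_bigr => k _; rewrite !colE mulmxA.
Qed.

Lemma qform_le n q (S S' : 'M[R]_n) (X : 'M[R]_(n, q)) :
  (forall x : 'cV_n, qform S x <= qform S' x) -> qform S X <= qform S' X.
Proof. by move=> H; rewrite !qform_col; apply: ler_sum => k _. Qed.

Lemma qform_psd_ge0 n q (S : 'M[R]_n) (X : 'M[R]_(n, q)) : psd S -> 0 <= qform S X.
Proof. by move=> [_ H]; rewrite qform_col; apply: sumr_ge0. Qed.

Lemma qformD n q (S S' : 'M[R]_n) (X : 'M[R]_(n, q)) :
  qform (S + S') X = qform S X + qform S' X.
Proof. by rewrite /qform mulmxDl innerDr. Qed.

Lemma qformN n q (S : 'M[R]_n) (X : 'M[R]_(n, q)) : qform (- S) X = - qform S X.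
Proof. by rewrite /qform mulNmx innerNr. Qed.

Lemma qformB n q (S S' : 'M[R]_n) (X : 'M[R]_(n, q)) :
  qform (S - S') X = qform S X - qform S' X.
Proof. by rewrite qformD qformN. Qed.

Lemma qformZ n q a (S : 'M[R]_n) (X : 'M[R]_(n, q)) :
  qform (a *: S) X = a * qform S X.
Proof. by rewrite /qform -scalemxAl innerZr. Qed.

Lemma qform1 n q (X : 'M[R]_(n, q)) : qform 1%:M X = inner X X.
Proof. by rewrite /qform mul1mx. Qed.

Lemma qform_congr n p q (S : 'M[R]_p) (A : 'M[R]_(p, n)) (X : 'M[R]_(n, q)) :
  qform (A^T *m S *m A) X = qform S (A *m X).
Proof. by rewrite /qform inner_mull !mulmxA. Qed.

Lemma qform_gram n p q (A : 'M[R]_(p, n)) (X : 'M[R]_(n, q)) :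
  qform (A^T *m A) X = inner (A *m X) (A *m X).
Proof. by rewrite /qform inner_mull mulmxA. Qed.

Lemma qform_tr n q (S : 'M[R]_n) (X : 'M[R]_(n, q)) : qform S^T X = qform S X.
Proof. by rewrite /qform -inner_mull inner_sym. Qed.

Lemma qformZr n q a (S : 'M[R]_n) (X : 'M[R]_(n, q)) :
  qform S (a *: X) = a ^+ 2 * qform S X.
Proof. by rewrite /qform -scalemxAr innerZl innerZr mulrA. Qed.

Lemma inner_selfadjoint n q (S : 'M[R]_n) (X Y : 'M[R]_(n, q)) :
  S^T = S -> inner X (S *m Y) = inner Y (S *m X).
Proof. by move=> sS; rewrite inner_sym inner_mull sS. Qed.

Lemma qformDr n q (S : 'M[R]_n) (X Y : 'M[R]_(n, q)) : S^T = S ->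
  qform S (X + Y) = qform S X + 2 * inner X (S *m Y) + qform S Y.
Proof.
move=> sS; rewrite /qform mulmxDr !innerDl !innerDr [inner Y (S *m X)]inner_selfadjoint //.
by ring.
Qed.

(** Positivity of the form at Y - t X. The free weight t is what lets the
    estimates below balance terms of different order in the perturbation. *)
Lemma psd_young n q (S : 'M[R]_n) (X Y : 'M[R]_(n, q)) (t : R) : psd S -> 0 < t ->
  2 * inner X (S *m Y) <= t * qform S X + t^-1 * qform S Y.
Proof.
move=> pS t0; have := qform_psd_ge0 (- t *: X + Y) pS.
rewrite qformDr ?qformZr ?innerZl; last by case: pS.
rewrite -(pmulr_rge0 _ (_ : 0 < t^-1)) ?invr_gt0 // => H.
rewrite -subr_ge0; apply: le_trans H _.
rewrite le_eqVlt; apply/orP; left; apply/eqP; field; exact: lt0r_neq0.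
Qed.

Lemma psd_cauchy_schwarz n q (S : 'M[R]_n) (X Y : 'M[R]_(n, q)) : psd S ->
  0 < qform S Y -> inner X (S *m Y) ^+ 2 / qform S Y <= qform S X.
Proof.
move=> pS qY; have := qform_psd_ge0 (X + (- (inner X (S *m Y) / qform S Y)) *: Y) pS.
rewrite qformDr ?qformZr; last by case: pS.
rewrite -scalemxAr innerZr => H; rewrite -subr_ge0; apply: le_trans H _.
rewrite le_eqVlt; apply/orP; left; apply/eqP; field; exact: lt0r_neq0.
Qed.

(** Young's inequality bounds |S X|^2 by an arbitrarily small multiple of the
    form at S X. *)
Lemma psd_qform_eq0 n q (S : 'M[R]_n) (X : 'M[R]_(n, q)) : psd S ->
  qform S X = 0 -> S *m X = 0.
Proof.
move=> pS qX; apply/eqP; rewrite -inner_eq0; apply/negPn/negP => nz.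
have a0 : 0 < inner (S *m X) (S *m X) by rewrite lt_def nz inner_ge0.
set Y := S *m X in a0 *; set a := inner Y Y in a0.
have b0 : 0 <= qform S Y by exact: qform_psd_ge0.
have t0 : 0 < a / (qform S Y + 1) by rewrite divr_gt0 // ltr_wpDl.
have := psd_young Y X pS t0; rewrite qX mulr0 addr0 -/Y -/a.
apply/negP; rewrite -ltNge mulrAC -mulrA.
have : qform S Y / (qform S Y + 1) < 1.
  by rewrite ltr_pdivrMr; [rewrite mul1r ltrDl | rewrite ltr_wpDl].
by rewrite -(ltr_pM2l a0) mulr1 => H; apply: lt_trans H _; lra.
Qed.

Lemma psd_rank1 n q (X : 'M[R]_(n, q)) : psd (X *m X^T).
Proof.
split=> [|x]; first by rewrite trmx_mul trmxK.
by rewrite -{1}[X]trmxK qform_gram inner_ge0.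
Qed.

Lemma inner_delta n (S : 'M[R]_n) k l :
  inner (delta_mx k 0 : 'cV_n) (S *m delta_mx l 0) = S k l.
Proof. by rewrite /inner trmx_delta mulmxA -rowE -colE trace_mx11 !mxE. Qed.

(** Sum over i and j the nonnegative values of the form at x_j e_i - x_i e_j;
    this avoids any spectral decomposition. *)
Lemma psd_qform_le_trace n (S : 'M[R]_n) (x : 'cV_n) : psd S ->
  qform S x <= \tr S * inner x x.
Proof.
move=> [sS pS].
have two0 : 0 < 2 :> R by [].
have minor i j : 2 * (x i 0 * S i j * x j 0) <= x j 0 ^+ 2 * S i i + x i 0 ^+ 2 * S j j.
  have := pS (x j 0 *: delta_mx i 0 + (- x i 0) *: delta_mx j 0).
  rewrite qformDr // !qformZr innerZl -scalemxAr innerZr /qform !inner_delta.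
  by rewrite -subr_ge0 => H; rewrite -subr_ge0; apply: le_trans H _; lra.
have -> : qform S x = \sum_i \sum_j x i 0 * S i j * x j 0.
  rewrite /qform innerE; apply: eq_bigr => i _; rewrite big_ord1 mxE mulr_sumr.
  by apply: eq_bigr => j _; rewrite mulrA.
rewrite -(ler_pM2l two0) mulr_sumr.
have -> : 2 * (\tr S * inner x x) =
   \sum_i \sum_j (x j 0 ^+ 2 * S i i + x i 0 ^+ 2 * S j j).
  under eq_bigr do rewrite big_split /= -mulr_suml -mulr_sumr.
  rewrite big_split /= -mulr_sumr -mulr_suml -/(\tr S).
  have -> : inner x x = \sum_i x i 0 ^+ 2.
    by rewrite innerE; apply: eq_bigr => i _; rewrite big_ord1.
  by ring.
by apply: ler_sum => i _; rewrite mulr_sumr; apply: ler_sum => j _.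
Qed.

(** Submultiplicativity of the Frobenius norm: E^T E is at most its trace. *)
Lemma inner_mul_le p r q (E : 'M[R]_(p, r)) (X : 'M[R]_(r, q)) :
  inner (E *m X) (E *m X) <= inner E E * inner X X.
Proof.
rewrite -qform_gram -[inner E E]/(\tr _) -qform1 -qformZ; apply: qform_le => x.
rewrite qformZ qform1; apply: psd_qform_le_trace.
by rewrite -{2}[E]trmxK; exact: psd_rank1.
Qed.

Lemma qform_bounded n (S : 'M[R]_n) :
  exists2 c, 0 < c & forall x : 'cV_n, `|qform S x| <= c * inner x x.
Proof.
exists (\sum_i \sum_j `|S i j| + 1) => [|x].
  by rewrite ltr_wpDl // sumr_ge0 // => i _; rewrite sumr_ge0.
have xx : inner x x = \sum_i x i 0 ^+ 2.
  by rewrite innerE; apply: eq_bigr => i _; rewrite big_ord1.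
have xi i : x i 0 ^+ 2 <= inner x x.
  by rewrite xx (bigD1 i) //= lerDl sumr_ge0 // => j _; rewrite sqr_ge0.
have -> : qform S x = \sum_i \sum_j x i 0 * S i j * x j 0.
  rewrite /qform innerE; apply: eq_bigr => i _; rewrite big_ord1 mxE mulr_sumr.
  by apply: eq_bigr => j _; rewrite mulrA.
rewrite mulrDl mul1r.
apply: le_trans (_ : (\sum_i \sum_j `|S i j|) * inner x x <= _); last first.
  by rewrite lerDl inner_ge0.
rewrite mulr_suml; apply: le_trans (ler_norm_sum _ _ _) _; apply: ler_sum => i _.
rewrite mulr_suml; apply: le_trans (ler_norm_sum _ _ _) _; apply: ler_sum => j _.
rewrite [_ * S i j]mulrC -mulrA normrM; apply: ler_wpM2l => //.
have := xi i; have := xi j.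
have := sqr_ge0 (x i 0 + x j 0); have := sqr_ge0 (x i 0 - x j 0).
by rewrite ler_norml => *; apply/andP; split; nra.
Qed.

(** Deflation: subtracting S e_k e_k^T S / S_kk keeps S positive semidefinite,
    makes it annihilate e_k, and removes a nonnegative rank-one contribution
    from the trace. After all basis vectors nothing is left of S. *)
Lemma trace_psd_ge0 n (U S : 'M[R]_n) : psd S ->
  (forall x : 'cV_n, 0 <= qform U x) -> 0 <= \tr (U *m S).
Proof.
move=> pS pU.
suff H k : (forall i : 'I_n, (k <= i)%N -> S *m delta_mx i (0 : 'I_1) = 0) ->
    0 <= \tr (U *m S).
  by apply: (H n) => i; rewrite leqNgt ltn_ord.
elim: k S pS => [|k IH] S pS Sk.
  have -> : S = 0.
    by apply/matrixP => i j; have /matrixP/(_ i 0) := Sk j isT; rewrite -colE !mxE.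
  by rewrite mulmx0 mxtrace0.
have [kn|nk] := ltnP k n; last first.
  by apply: (IH S pS) => i ki; have := ltn_ord i; rewrite ltnNge (leq_trans nk ki).
pose e : 'cV[R]_n := delta_mx (Ordinal kn) 0.
have next (S' : 'M[R]_n) : S' *m e = 0 -> (forall i : 'I_n, (k < i)%N ->
    S' *m delta_mx i (0 : 'I_1) = 0) ->
    forall i : 'I_n, (k <= i)%N -> S' *m delta_mx i (0 : 'I_1) = 0.
  move=> S'e S'k i; rewrite leq_eqVlt => /orP[/eqP ki|]; last exact: S'k.
  by rewrite -S'e /e; congr (_ *m delta_mx _ _); apply: val_inj.
have [qe|qe] := eqVneq (qform S e) 0.
  by apply: (IH S pS); apply: next => //; exact: psd_qform_eq0.
have q0 : 0 < qform S e by rewrite lt_def qe; case: pS => _ ->.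
have sS : S^T = S by case: pS.
pose v := S *m e; pose S' := S - (qform S e)^-1 *: (v *m v^T).
have vT (x : 'cV[R]_n) : v^T *m x = (inner e (S *m x))%:M.
  rewrite [LHS]mx11_scalar; congr (_ %:M).
  by rewrite -trace_mx11 inner_selfadjoint // inner_sym.
have S'x (x : 'cV[R]_n) : S' *m x = S *m x - (inner e (S *m x) / qform S e) *: v.
  by rewrite mulmxBl -scalemxAl -mulmxA vT mul_mx_scalar scalerA mulrC.
have -> : \tr (U *m S) = \tr (U *m S') + (qform S e)^-1 * qform U v.
  have -> : qform U v = \tr (U *m (v *m v^T)) by rewrite mulmxA mxtrace_mulC.
  by rewrite -mxtraceZ -mxtraceD scalemxAr -mulmxDr /S' subrK.
apply: addr_ge0; last by rewrite mulr_ge0 // invr_ge0 ltW.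
apply: IH.
  split; first by rewrite /S' linearB linearZ /= trmx_mul trmxK sS.
  move=> x; rewrite /qform S'x innerBr innerZr subr_ge0.
  have := psd_cauchy_schwarz x pS q0.
  by rewrite [inner e _]inner_selfadjoint // -/v expr2 mulrAC.
apply: next => [|i ki]; first by rewrite S'x divff // scale1r subrr.
by rewrite S'x Sk // inner0r mul0r scale0r subrr.
Qed.

Lemma trace_psd_le n (U V S : 'M[R]_n) : psd S ->
  (forall x : 'cV_n, qform U x <= qform V x) -> \tr (U *m S) <= \tr (V *m S).
Proof.
move=> pS UV; rewrite -subr_ge0 -linearB -mulmxBl; apply: trace_psd_ge0 => // x.
by rewrite qformB subr_ge0.
Qed.

Lemma trace_psd_eq n (U V S : 'M[R]_n) : psd S ->
  (forall x : 'cV_n, qform U x = qform V x) -> \tr (U *m S) = \tr (V *m S).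
Proof.
by move=> pS UV; apply/eqP; rewrite eq_le; apply/andP; split;
  apply: trace_psd_le => // x; rewrite UV.
Qed.

(** Polarized form of a two-sided bound on a symmetric matrix: add Young's
    inequalities for the positive semidefinite matrices k + Y and k - Y. *)
Lemma bilinear_young n (Y : 'M[R]_n) (k t : R) (u v : 'cV_n) :
  Y^T = Y -> (forall x : 'cV_n, `|qform Y x| <= k * inner x x) -> 0 < t ->
  `|2 * inner u (Y *m v)| <= k * (t * inner u u + t^-1 * inner v v).
Proof.
move=> sY hY t0.
have pD (s : R) : s ^+ 2 = 1 -> psd (k%:M + s *: Y).
  move=> s1; split; first by rewrite linearD linearZ /= tr_scalar_mx sY.
  move=> x; rewrite qformD -scalemx1 !qformZ qform1.
  have := hY x; rewrite ler_norml => /andP[h1 h2].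
  by move/eqP: s1; rewrite sqrf_eq1 => /orP[] /eqP ->; lra.
have p1 := pD 1 (expr1n _ _).
have p2 : psd (k%:M + (-1) *: Y) by apply: pD; rewrite sqrrN expr1n.
have k1 s (w z : 'cV_n) :
    inner w ((k%:M + s *: Y) *m z) = k * inner w z + s * inner w (Y *m z).
  by rewrite mulmxDl mul_scalar_mx -scalemxAl innerDr !innerZr.
rewrite ler_norml; apply/andP; split.
- have := psd_young (-1 *: u) v p1 t0; have := psd_young u v p2 t0.
  by rewrite !qformZr !innerZl /qform !k1; lra.
- have := psd_young u v p1 t0; have := psd_young (-1 *: u) v p2 t0.
  by rewrite !qformZr !innerZl /qform !k1; lra.
Qed.

End QuadraticForms.

(** * Matrix norms and singular values *)

Section SingularValues.
Context {R : realType}.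

Lemma frobenius_normE p q (M : 'M[R]_(p, q)) :
  frobenius_norm M = Num.sqrt (inner M M).
Proof. by rewrite innerE. Qed.

Lemma frobenius_norm_ge0 p q (M : 'M[R]_(p, q)) : 0 <= frobenius_norm M.
Proof. exact: sqrtr_ge0. Qed.

Lemma sqr_frobenius_norm p q (M : 'M[R]_(p, q)) :
  frobenius_norm M ^+ 2 = inner M M.
Proof. by rewrite frobenius_normE sqr_sqrtr ?inner_ge0. Qed.

Lemma le_frobenius_norm p q p' q' (M : 'M[R]_(p, q)) (M' : 'M[R]_(p', q')) c :
  0 <= c ->
  (frobenius_norm M <= c * frobenius_norm M') = (inner M M <= c ^+ 2 * inner M' M').
Proof.
move=> c0; rewrite -!sqr_frobenius_norm -exprMn ler_pXn2r ?nnegrE //.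
  exact: frobenius_norm_ge0.
by rewrite mulr_ge0 // frobenius_norm_ge0.
Qed.

Lemma spectral_norm_has_sup p q (M : 'M[R]_(p, q)) :
  has_sup [set frobenius_norm (M *m x) | x in
        [set x : 'cV[R]_q | frobenius_norm x <= 1]].
Proof.
split.
  exists (frobenius_norm (M *m (0 : 'cV_q))); exists 0 => //=.
  by rewrite frobenius_normE inner0r sqrtr0.
exists (frobenius_norm M) => _ [x /= x1 <-].
apply: (@le_trans _ _ (frobenius_norm M * frobenius_norm x)).
  by rewrite le_frobenius_norm ?frobenius_norm_ge0 // sqr_frobenius_norm inner_mul_le.
by rewrite ler_piMr ?frobenius_norm_ge0.
Qed.

Lemma spectral_norm_ge0 p q (M : 'M[R]_(p, q)) : 0 <= spectral_norm M.
Proof.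
apply: le_trans (ub_le_sup (proj2 (spectral_norm_has_sup M)) _).
  exact: (frobenius_norm_ge0 (M *m (0 : 'cV_q))).
by exists 0 => //=; rewrite frobenius_normE inner0r sqrtr0.
Qed.

Lemma spectral_norm_mul_le p q r (M : 'M[R]_(p, q)) (X : 'M[R]_(q, r)) :
  inner (M *m X) (M *m X) <= spectral_norm M ^+ 2 * inner X X.
Proof.
rewrite -qform_gram -qform1 -qformZ; apply: qform_le => x.
rewrite qformZ qform1 qform_gram.
have [->|x0] := eqVneq x 0; first by rewrite mulmx0 !inner0r mulr0.
have fx : 0 < frobenius_norm x by rewrite frobenius_normE sqrtr_gt0 inner_gt0.
rewrite -le_frobenius_norm ?spectral_norm_ge0 // -ler_pdivrMr //.
apply: ub_le_sup; first exact: proj2 (spectral_norm_has_sup M).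
have nZ s k (v : 'M[R]_(s, k)) : frobenius_norm ((frobenius_norm x)^-1 *: v) =
    frobenius_norm v / frobenius_norm x.
  rewrite frobenius_normE innerZl innerZr mulrA -expr2 sqrtrM ?sqr_ge0 //.
  by rewrite sqrtr_sqr ger0_norm ?invr_ge0 ?ltW // mulrC -frobenius_normE.
exists ((frobenius_norm x)^-1 *: x); first by rewrite /= nZ divff ?lt0r_neq0.
by rewrite -scalemxAr nZ.
Qed.

Lemma spectral_norm_gt0 p q (M : 'M[R]_(p, q)) : M != 0 -> 0 < spectral_norm M.
Proof.
move=> M0; rewrite lt_def spectral_norm_ge0 andbT; apply: contraNneq M0 => s0.
have := spectral_norm_mul_le M 1%:M; rewrite s0 expr0n mul0r mulmx1.
by rewrite -inner_eq0 eq_le inner_ge0 andbT.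
Qed.

Lemma psd1 n : psd (1%:M : 'M[R]_n).
Proof. by split=> [|x]; rewrite ?trmx1 // qform1 inner_ge0. Qed.

(** Cauchy-Schwarz, in the form of Young's inequality for the identity matrix
    with weight the norm of S. *)
Lemma qform_le_spectral_norm n q (S : 'M[R]_n) (X : 'M[R]_(n, q)) :
  qform S X <= spectral_norm S * inner X X.
Proof.
have [->|S0] := eqVneq S 0.
  by rewrite /qform mul0mx inner0r mulr_ge0 ?spectral_norm_ge0 ?inner_ge0.
have s0 := spectral_norm_gt0 S0; have := psd_young X (S *m X) (psd1 n) s0.
rewrite mul1mx !qform1 -/(qform S X) => H.
have := spectral_norm_mul_le S X.
rewrite -(ler_pM2l (_ : 0 < (spectral_norm S)^-1)) ?invr_gt0 //.
rewrite [X in _ <= X -> _]mulrA [_^-1 * _ ^+ 2]mulrC expr2 mulfK ?lt0r_neq0 // => H2.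
by lra.
Qed.

(** The supremum l of the lower bounds of the Rayleigh quotient is an
    eigenvalue: otherwise S - l would be positive semidefinite and invertible,
    hence coercive, and l could be increased. *)
Lemma rayleigh_min n (S : 'M[R]_n) : (0 < n)%N -> S^T = S ->
  exists2 l, eigenvalue S l & forall x : 'cV_n, l * inner x x <= qform S x.
Proof.
move=> n0 sS.
pose E := [set l | forall x : 'cV[R]_n, l * inner x x <= qform S x].
have [b b0 hb] := qform_bounded S.
have E0 : E !=set0.
  by exists (- b) => x; have := hb x; rewrite mulNr lerNl ler_norml => /andP[H _]; lra.
pose e : 'cV[R]_n := delta_mx (Ordinal n0) 0.
have supE l : E l -> l <= sup E.
  apply: ub_le_sup; exists (qform S e) => k /(_ e).
  suff -> : inner e e = 1 by rewrite mulr1.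
  by rewrite /inner trmx_delta mul_delta_mx trace_mx11 mxE.
have Esup : E (sup E).
  move=> x; have [->|x0] := eqVneq x 0; first by rewrite inner0r mulr0 /qform mulmx0 inner0r.
  rewrite -ler_pdivlMr ?inner_gt0 //; apply: ge_sup => // l /(_ x).
  by rewrite -ler_pdivlMr ?inner_gt0.
exists (sup E) => //; rewrite /eigenvalue /eigenspace kermx_eq0 row_free_unit.
set T := S - _; apply/negP => uT.
have pT : psd T.
  split; first by rewrite /T linearB /= tr_scalar_mx sS.
  by move=> x; rewrite /T qformB -scalemx1 qformZ qform1 subr_ge0.
have [c c0 hc] := qform_bounded (invmx T).
(* Coercivity: Young's inequality for T at x and T^-1 x, with the bound c on
   the form of T^-1. *)
suff /supE : E (sup E + c^-1) by rewrite leNgt ltrDl invr_gt0 c0.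
move=> x; rewrite -subr_ge0 mulrDl opprD addrA subr_ge0.
have -> : qform S x - sup E * inner x x = qform T x.
  by rewrite /T qformB -scalemx1 qformZ qform1.
have := psd_young x (invmx T *m x) pT c0.
rewrite mulKVmx // {2}/qform mulKVmx // [inner (_ *m _) x]inner_sym -/(qform _ x).
have := hc x; rewrite ler_norml => /andP[_ h1].
rewrite -[c^-1 * _ <= _](ler_pM2l c0) mulVKf ?lt0r_neq0 //.
have h2 : c^-1 * qform (invmx T) x <= inner x x.
  by rewrite -(ler_pM2l c0) mulVKf ?lt0r_neq0.
by move=> h; lra.
Qed.

Lemma singular_value_sqr_gram p q (M : 'M[R]_(p, q)) s :
  (q <= p)%N -> singular_value M s <-> 0 <= s /\ eigenvalue (M^T *m M) (s ^+ 2).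
Proof. by rewrite /singular_value => ->. Qed.

Lemma sigma_min_ge0 p q (M : 'M[R]_(p, q)) : 0 <= sigma_min M.
Proof.
rewrite /sigma_min; have [->|/set0P E0] := eqVneq [set s | singular_value M s] set0.
  by rewrite inf0.
by apply: lb_le_inf => // s [].
Qed.

Lemma sigma_min_le p q (M : 'M[R]_(p, q)) s : singular_value M s -> sigma_min M <= s.
Proof.
move=> Ms; apply: ge_inf => //; exists 0 => t [] //.
Qed.

(** The least eigenvalue of M^T M is the square of a singular value. *)
Lemma gram_rayleigh_min p q (M : 'M[R]_(p, q)) : (0 < q)%N -> (q <= p)%N ->
  exists2 s, singular_value M s &
    forall x : 'cV_q, s ^+ 2 * inner x x <= inner (M *m x) (M *m x).
Proof.
move=> q0 qp; have [|l ev hl] := @rayleigh_min _ (M^T *m M) q0.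
  by rewrite trmx_mul trmxK.
have l0 : 0 <= l.
  move/eigenvalueP: ev => [v /(congr1 trmx)]; rewrite trmx_mul linearZ /= => vE v0.
  have v1 : v^T != 0 by rewrite -trmx0 (inj_eq trmx_inj).
  rewrite -(pmulr_lge0 _ (_ : 0 < inner v^T v^T)) ?inner_gt0 //.
  by rewrite -innerZr -vE trmx_mul trmxK -/(qform _ _) qform_gram inner_ge0.
exists (Num.sqrt l); first by apply/singular_value_sqr_gram => //; rewrite sqrtr_ge0 sqr_sqrtr.
by move=> x; rewrite sqr_sqrtr // -qform_gram.
Qed.

Lemma sigma_min_mul_le p q (M : 'M[R]_(p, q)) r (X : 'M[R]_(q, r)) : (q <= p)%N ->
  sigma_min M ^+ 2 * inner X X <= inner (M *m X) (M *m X).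
Proof.
move=> qp; rewrite -qform_gram -qform1 -qformZ; apply: qform_le => x.
rewrite qformZ qform1 qform_gram.
have [q0|] := posnP q; first by subst q; rewrite [x]flatmx0 mulmx0 !inner0r mulr0.
move=> /gram_rayleigh_min /(_ qp) -/(_ M) [s Ms hs].
apply: le_trans (hs x); rewrite ler_wpM2r ?inner_ge0 //.
rewrite ler_pXn2r ?nnegrE ?sigma_min_ge0 ?sigma_min_le //.
by case: Ms.
Qed.

(** Here sigma_min refers to S^T S = S^2, whose eigenvalue l^2 comes from the
    least eigenvalue l >= 0 of S. *)
Lemma sigma_min_qform_le n q (S : 'M[R]_n) (X : 'M[R]_(n, q)) : psd S ->
  sigma_min S * inner X X <= qform S X.
Proof.
move=> pS; rewrite -qform1 -qformZ; apply: qform_le => x.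
rewrite qformZ qform1; case: (pS) => sS pS'.
have [n0|n0] := posnP n; first by subst n; rewrite [x]flatmx0 /qform mulmx0 !inner0r mulr0.
have [l ev hl] := rayleigh_min n0 sS.
apply: le_trans (hl x); rewrite ler_wpM2r ?inner_ge0 //.
move/eigenvalueP: ev => [v vE v0].
have l0 : 0 <= l.
  have v1 : v^T != 0 by rewrite -trmx0 (inj_eq trmx_inj).
  rewrite -(pmulr_lge0 _ (_ : 0 < inner v^T v^T)) ?inner_gt0 //.
  have := pS' v^T; rewrite /qform -{1}sS -trmx_mul vE linearZ /= innerZr.
  by [].
apply: sigma_min_le; apply/singular_value_sqr_gram => //; split => //.
by apply/eigenvalueP; exists v => //; rewrite sS mulmxA vE -scalemxAl vE scalerA expr2.
Qed.

(** Every singular value is at least the inverse of the norm of M^-1. *)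
Lemma sigma_min_gt0 n (M : 'M[R]_n) : (0 < n)%N -> M \in unitmx -> 0 < sigma_min M.
Proof.
move=> n0 uM; have M0 : invmx M != 0.
  apply/eqP => M0; have := mulmxV uM; rewrite M0 mulmx0 => /esym/matrixP.
  by move/(_ (Ordinal n0) (Ordinal n0)); rewrite !mxE eqxx => /eqP; rewrite oner_eq0.
have c0 := spectral_norm_gt0 M0.
apply: lt_le_trans (_ : (spectral_norm (invmx M))^-1 <= _); first by rewrite invr_gt0.
apply: lb_le_inf.
  by have [s Ms _] := gram_rayleigh_min M n0 (leqnn n); exists s.
move=> s /singular_value_sqr_gram -/(_ (leqnn n)) [s0 /eigenvalueP[v vE v0]].
have v1 : 0 < inner v^T v^T by rewrite inner_gt0 -trmx0 (inj_eq trmx_inj).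
have sq : s ^+ 2 * inner v^T v^T = inner (M *m v^T) (M *m v^T).
  rewrite -qform_gram -innerZr /qform; congr inner.
  by rewrite -linearZ /= -vE !trmx_mul trmxK.
rewrite -div1r ler_pdivrMr // -(ler_pXn2r (_ : 0 < 2)%N) ?nnegrE //; last first.
  by rewrite mulr_ge0 // ltW.
rewrite expr1n exprMn -(ler_pM2r v1) mul1r mulrAC sq mulrC.
by have := spectral_norm_mul_le (invmx M) (M *m v^T); rewrite mulKmx.
Qed.

Lemma sym_posdef_qform_gt0 n (S : 'M[R]_n) (x : 'cV_n) :
  sym_posdef S -> x != 0 -> 0 < qform S x.
Proof. by move=> [_ H] /H; rewrite /qform /inner trace_mx11 mulmxA. Qed.

Lemma sym_posdef_psd n (S : 'M[R]_n) : sym_posdef S -> psd S.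
Proof.
move=> pS; split; first by case: pS.
move=> x; have [->|x0] := eqVneq x 0; first by rewrite /qform mulmx0 inner0r.
exact/ltW/sym_posdef_qform_gt0.
Qed.

Lemma sym_posdef_unit n (S : 'M[R]_n) : sym_posdef S -> S \in unitmx.
Proof.
move=> pS; rewrite -row_free_unit -kermx_eq0; apply/rowV0P => v /sub_kermxP vS.
apply/eqP/negPn/negP => v0; have := @sym_posdef_qform_gt0 _ S v^T pS.
rewrite -trmx0 (inj_eq trmx_inj) => /(_ v0).
case: pS => sS _; rewrite /qform -sS -trmx_mul vS trmx0 inner0r ltxx //.
Qed.

End SingularValues.

(** * Stable matrices *)

Section Stability.
Context {R : realType}.

(** A spectral radius below 1 gives this decay, on which the theory of Lyapunov
    equations rests. *)
Definition stable n (M : 'M[R]_n) : Prop :=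
  forall (x : 'cV[R]_n) i, (fun t => iter t (mulmx M) x i 0) @ \oo --> (0 : R).

Local Notation normc := ComplexField.Normc.normc.

Lemma normc_ge0 (z : R[i]) : 0 <= normc z.
Proof. by case: z => a b; exact: sqrtr_ge0. Qed.

Lemma normc_real (a : R) : normc (real_complex R a) = `|a|.
Proof. by rewrite /= expr0n addr0 sqrtr_sqr. Qed.

(** With v' = (M - z) v, every entry of the trajectory satisfies
    x_(t+1) = z x_t + y_t where y is the trajectory of v'. For |z| < 1 summable y
    gives summable x, so the factors of the annihilating polynomial can be
    peeled off one at a time. *)
Lemma summable_trajectory n (M : 'M[R[i]]_n.+1) (r : seq R[i]) (v : 'cV_n.+1) i :
  (forall z, z \in r -> normc z < 1) ->
  horner_mx M (\prod_(z <- r) ('X - z%:P)) *m v = 0 ->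
  exists c, forall k, \sum_(t < k) normc (iter t (mulmx M) v i 0) <= c.
Proof.
elim: r v => [|z r IH] v hr.
  rewrite big_nil rmorph1 mul1mx => ->; exists 0 => k.
  rewrite big1 // => t _; suff -> : iter t (mulmx M) (0 : 'cV_n.+1) = 0.
    by rewrite mxE ComplexField.Normc.normc0.
  by elim: (t : nat) => // s /= ->; rewrite mulmx0.
rewrite big_cons mulrC rmorphM /= rmorphB /= horner_mx_X horner_mx_C -mulmxA => /IH.
case=> [w wr|c hc]; first by apply: hr; rewrite inE wr orbT.
have z1 : normc z < 1 by apply: hr; rewrite inE eqxx.
have z0 := normc_ge0 z.
have step t : iter t.+1 (mulmx M) v i 0 =
    z * iter t (mulmx M) v i 0 + iter t (mulmx M) ((M - z%:M) *m v) i 0.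
  suff -> : iter t (mulmx M) ((M - z%:M) *m v) =
      iter t.+1 (mulmx M) v - z *: iter t (mulmx M) v.
    by rewrite !mxE addrCA subrr addr0.
  elim: t => [|t IHt]; first by rewrite /= mulmxBl mul_scalar_mx.
  by rewrite iterS IHt mulmxBr -scalemxAr -!iterS.
pose a := normc (v i 0).
have c0 : 0 <= c by have := hc 0%N; rewrite big_ord0.
exists ((a + c) / (1 - normc z)) => k.
have d0 : 0 < 1 - normc z by rewrite subr_gt0.
have ac : 0 <= a + c by rewrite addr_ge0 // normc_ge0.
elim: k => [|k IHk]; first by rewrite big_ord0 divr_ge0 // ltW.
rewrite big_ord_recl -/a; under eq_bigr => t _ do rewrite lift0 step.
apply: (@le_trans _ _ (a + (normc z * (\sum_(t < k) normc (iter t (mulmx M) v i 0)) + c))).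
  rewrite lerD2l.
  apply: le_trans (_ : _ <=
    normc z * (\sum_(t < k) normc (iter t (mulmx M) v i 0)) +
    \sum_(t < k) normc (iter t (mulmx M) ((M - z%:M) *m v) i 0)) _; last by rewrite lerD2l.
  rewrite mulr_sumr -big_split /=; apply: ler_sum => t _.
  by rewrite -ComplexField.Normc.normcM; exact: le_normcD.
apply: (@le_trans _ _ (a + c + normc z * ((a + c) / (1 - normc z)))).
  by rewrite addrCA addrC lerD2l ler_wpM2l.
rewrite le_eqVlt; apply/orP; left; apply/eqP; field; exact: lt0r_neq0.
Qed.

(** The eigenvalues are among finitely many roots, so the supremum defining the
    spectral radius is an upper bound. *)
Lemma eigenvalue_normc_le n (M : 'M[R]_n) (z : R[i]) :
  eigenvalue (map_mx (real_complex R) M) z -> normc z <= spectral_radius M.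
Proof.
move=> Mz; apply: ub_le_sup; last by exists z.
have [r rE] := closed_field_poly_normal (char_poly (map_mx (real_complex R) M)).
rewrite (monicP (char_poly_monic _)) scale1r in rE.
exists (\sum_(w <- r) normc w) => _ [w /= + <-].
rewrite eigenvalue_root_char rE root_prod_XsubC => wr.
by rewrite (big_rem w) //= lerDl sumr_ge0 // => u _; exact: normc_ge0.
Qed.

(** Cayley-Hamilton: the characteristic polynomial splits over R[i] and
    annihilates M, so all entries of trajectories are absolutely summable. *)
Lemma eigenvalue_lt1_stable n (M : 'M[R]_n) :
  (forall z, eigenvalue (map_mx (real_complex R) M) z -> normc z < 1) -> stable M.
Proof.
case: n M => [|n] M ev1 x i; first by case: i.
pose Mc := map_mx (real_complex R) M.
have [r rE] := closed_field_poly_normal (char_poly Mc).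
rewrite (monicP (char_poly_monic _)) scale1r in rE.
have r1 z : z \in r -> normc z < 1.
  move=> zr; apply: ev1.
  by rewrite eigenvalue_root_char rE root_prod_XsubC.
have [|c hc] := @summable_trajectory _ Mc r (map_mx (real_complex R) x) i r1.
  by rewrite -rE Cayley_Hamilton mul0mx.
have tr t : iter t (mulmx Mc) (map_mx (real_complex R) x) =
    map_mx (real_complex R) (iter t (mulmx M) x).
  by elim: t => //= t ->; rewrite map_mxM.
apply/norm_cvg0P; apply: (@cvg_series_cvg_0 _ R^o); apply: nondecreasing_is_cvgn.
  by apply/nondecreasing_series => k _ _ /=; exact: normr_ge0.
exists c => _ [k _ <-]; apply: le_trans (hc k).
rewrite /series /= big_mkord le_eqVlt; apply/orP; left; apply/eqP.
by apply: eq_bigr => t _; rewrite tr mxE normc_real.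
Qed.

Lemma spectral_radius_lt1_stable n (M : 'M[R]_n) : spectral_radius M < 1 -> stable M.
Proof.
move=> rho1; apply: eigenvalue_lt1_stable => z /eigenvalue_normc_le.
by move=> /le_lt_trans; apply.
Qed.

Lemma cvgn_sum n (f : 'I_n -> nat -> R) (a : 'I_n -> R) :
  (forall i, f i @ \oo --> a i) -> (fun t => \sum_i f i t) @ \oo --> \sum_i a i.
Proof.
move=> fa; elim: (index_enum _) => [|i r IH].
  by rewrite big_nil; under eq_cvg do rewrite big_nil; exact: cvg_cst.
rewrite big_cons; under eq_cvg do rewrite big_cons.
by apply: cvgD => //; exact: fa.
Qed.

Lemma stable_inner_cvg0 n (M X : 'M[R]_n) (x y : 'cV_n) : stable M ->
  (fun t => inner (iter t (mulmx M) x) (X *m iter t (mulmx M) y)) @ \oo --> (0 : R).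
Proof.
move=> sM; rewrite (_ : (fun t => _) = (fun t => \sum_i \sum_j
   iter t (mulmx M) x i 0 * (X i j * iter t (mulmx M) y j 0))); last first.
  apply: funext => t; rewrite innerE; apply: eq_bigr => i _.
  by rewrite big_ord1 mxE mulr_sumr.
rewrite [X in _ --> X](_ : _ = \sum_(i < n) \sum_(j < n) (0 : R) * (X i j * 0)); last first.
  by rewrite big1 // => i _; rewrite big1 // => j _; rewrite mul0r.
apply: cvgn_sum => i; apply: cvgn_sum => j.
by apply: cvgM; [exact: sM | apply: cvgM; [exact: cvg_cst | exact: sM]].
Qed.

(** The bilinear form of such an X is constant along trajectories, which decay. *)
Lemma lyapunov_eq0 n (M X : 'M[R]_n) : stable M -> X = M^T *m X *m M -> X = 0.
Proof.
move=> sM XE.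
have inv (x y : 'cV[R]_n) t :
    inner (iter t (mulmx M) x) (X *m iter t (mulmx M) y) = inner x (X *m y).
  by elim: t => // t <- /=; rewrite inner_mull !mulmxA -XE.
suff X0 (x y : 'cV[R]_n) : inner x (X *m y) = 0.
  by apply/matrixP => i j; rewrite -inner_delta X0 mxE.
have := @stable_inner_cvg0 _ M X x y sM.
rewrite (_ : (fun t => _) = cst (inner x (X *m y))); last exact/funext/inv.
by move/(cvg_unique _ (@cvg_cst _ _ _ _ _)); apply.
Qed.

(** In finite dimension the injectivity of X |-> X - M^T X M suffices. *)
Lemma lyapunov_solution n (M W : 'M[R]_n) : stable M ->
  exists X, X = W + M^T *m X *m M.
Proof.
move=> sM.
pose f : 'End('M[R]_n) := (\1%VF - (linfun (mulmxr M) \o linfun (mulmx M^T)))%VF.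
have fE X : f X = X - M^T *m X *m M.
  by rewrite /f add_lfunE opp_lfunE id_lfunE comp_lfunE !lfunE.
have f0 : lker f == 0%VS.
  apply/lker0P => X Y; rewrite !fE => XY.
  apply/eqP; rewrite -subr_eq0; apply/eqP/(lyapunov_eq0 sM)/eqP.
  by rewrite mulmxBr mulmxBl subr_eq addrC addrA addrAC -XY subrK.
by exists (f^-1%VF W); rewrite -[in X in X + _](lker0_lfunVK f0 W) fE subrK.
Qed.

End Stability.

(** * Lyapunov equations *)

Section Lyapunov.
Context {R : realType}.
Local Notation normc := ComplexField.Normc.normc.

Lemma eigenvalue_unitmx (F : fieldType) n (M : 'M[F]_n) z :
  eigenvalue M z = (M - z%:M \notin unitmx).
Proof. by rewrite /eigenvalue /eigenspace kermx_eq0 row_free_unit. Qed.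

Lemma eigenvalue_trmx (F : fieldType) n (M : 'M[F]_n) z :
  eigenvalue M^T z = eigenvalue M z.
Proof. by rewrite !eigenvalue_unitmx -[in RHS]unitmx_tr linearB /= tr_scalar_mx. Qed.

(** The real and imaginary parts of a complex eigenvector. *)
Lemma eigenvalue_real_pair n (M : 'M[R]_n) (z : R[i]) :
  eigenvalue (map_mx (real_complex R) M) z ->
  exists a b : 'cV[R]_n, [/\ (a != 0) || (b != 0),
    M *m a = complex.Re z *: a - complex.Im z *: b &
    M *m b = complex.Re z *: b + complex.Im z *: a].
Proof.
rewrite -eigenvalue_trmx => /eigenvalueP[v vE v0].
exists (map_mx (@complex.Re R) v^T), (map_mx (@complex.Im R) v^T).
have E i : \sum_j (real_complex R (M i j)) * v 0 j = z * v 0 i.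
  have /matrixP/(_ 0 i) := vE; rewrite !mxE => <-.
  by apply: eq_bigr => j _; rewrite !mxE mulrC.
split.
- apply: contraR v0; rewrite negb_or !negbK => /andP[/eqP/matrixP a0 /eqP/matrixP b0].
  apply/eqP/matrixP => i j; rewrite ord1; have := a0 j 0; have := b0 j 0; rewrite !mxE.
  by case: (v 0 j) => s t /= -> ->.
- apply/matrixP => i j; rewrite ord1 !mxE; have /(congr1 (@complex.Re R)) := E i.
  rewrite raddf_sum /= => H.
  rewrite (eq_bigr (fun j => complex.Re (real_complex R (M i j) * v 0 j))).
    by rewrite H; case: z {vE E H} => s t; case: (v 0 i) => u w /=.
  by move=> k _; rewrite !mxE; case: (v 0 k) => u w /=; rewrite mul0r subr0.
- apply/matrixP => i j; rewrite ord1 !mxE; have /(congr1 (@complex.Im R)) := E i.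
  rewrite raddf_sum /= => H.
  rewrite (eq_bigr (fun j => complex.Im (real_complex R (M i j) * v 0 j))).
    by rewrite H; case: z {vE E H} => s t; case: (v 0 i) => u w /=.
  by move=> k _; rewrite !mxE; case: (v 0 k) => u w /=; rewrite mul0r addr0.
Qed.

(** The form P contracts along M by the factor 1 - c / p. On a complex
    eigenvector a + i b the sum of its values at a and b is multiplied by |z|^2,
    which bounds all eigenvalues uniformly away from the unit circle. *)
Lemma lyapunov_spectral_radius_lt1 n (M P : 'M[R]_n) (c : R) : 0 < c -> psd P ->
  (forall x : 'cV_n, c * inner x x <= qform P x - qform P (M *m x)) ->
  spectral_radius M < 1.
Proof.
move=> c0 pP hc; have [p p0 hp] := qform_bounded P.
have [sP P0] := pP.
have rlt : 1 - c / p < 1 by rewrite ltrBlDr ltrDl divr_gt0.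
have bnd z : eigenvalue (map_mx (real_complex R) M) z -> normc z <= Num.sqrt (1 - c / p).
  move=> /eigenvalue_real_pair[a [b [ab Ma Mb]]].
  have ab0 : 0 < inner a a + inner b b.
    case/orP: ab; rewrite -inner_gt0 => H; first by rewrite ltr_wpDr ?inner_ge0.
    by rewrite ltr_wpDl ?inner_ge0.
  set S := qform P a + qform P b.
  have Sp : S <= p * (inner a a + inner b b).
    rewrite mulrDr lerD //; [have := hp a|have := hp b]; exact: le_trans (ler_norm _).
  have Sc : c * (inner a a + inner b b) <= S - (complex.Re z ^+ 2 + complex.Im z ^+ 2) * S.
    have := lerD (hc a) (hc b); rewrite Ma Mb -scaleNr !qformDr // !qformZr.
    rewrite -!scalemxAr !innerZl !innerZr [inner b (P *m a)]inner_selfadjoint // -mulrDr => H.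
    by apply: le_trans H _; rewrite le_eqVlt; apply/orP; left; apply/eqP; rewrite /S; ring.
  have S0 : 0 < S.
    have : 0 < c * (inner a a + inner b b) by rewrite mulr_gt0.
    have : 0 <= (complex.Re z ^+ 2 + complex.Im z ^+ 2) * S.
      by rewrite mulr_ge0 ?addr_ge0 ?sqr_ge0 // ?P0.
    by move=> *; lra.
  have -> : normc z = Num.sqrt (complex.Re z ^+ 2 + complex.Im z ^+ 2) by case: z {Ma Mb Sc}.
  apply: ler_wsqrtr; rewrite -(ler_pM2r S0) mulrBl mul1r.
  suff : c / p * S <= c * (inner a a + inner b b) by move=> *; lra.
  by rewrite mulrAC ler_pdivrMr // -mulrA ler_pM2l // mulrC.
rewrite /spectral_radius; set E := (X in sup X).
have [->|/set0P E0] := eqVneq E set0; first by rewrite sup0.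
apply: (@le_lt_trans _ _ (Num.sqrt (1 - c / p))).
  by apply: ge_sup => // _ [z /= /bnd zb <-].
by rewrite -[X in _ < X]sqrtr1 ltr_sqrt.
Qed.

Lemma lyapunov_lincomb n (M U X U' X' : 'M[R]_n) a b :
  X = U + M^T *m X *m M -> X' = U' + M^T *m X' *m M ->
  a *: X + b *: X' = (a *: U + b *: U') + M^T *m (a *: X + b *: X') *m M.
Proof.
move=> XE XE'; rewrite mulmxDr mulmxDl -!scalemxAr -!scalemxAl addrACA.
by rewrite -!scalerDr -XE -XE'.
Qed.

(** Iterating X = U + M^T X M exhibits the form of X as a sum of nonnegative
    terms plus a remainder that tends to 0. This comparison principle yields all
    order relations between solutions of Lyapunov equations. *)
Lemma lyapunov_ge0 n (M U X : 'M[R]_n) : stable M -> X = U + M^T *m X *m M ->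
  (forall x : 'cV_n, 0 <= qform U x) -> forall x : 'cV_n, 0 <= qform X x.
Proof.
move=> sM XE U0 x.
have dec t : qform X (iter t (mulmx M) x) <= qform X x.
  elim: t => //= t; apply: le_trans.
  by rewrite {2}XE qformD qform_congr lerDr.
by apply: (cvgr_to_le (stable_inner_cvg0 X x x sM)); apply: nearW.
Qed.

Lemma lyapunov_tr n (M U X : 'M[R]_n) : stable M -> X = U + M^T *m X *m M ->
  U^T = U -> X^T = X.
Proof.
move=> sM XE sU; apply/eqP; rewrite -subr_eq0; apply/eqP/(lyapunov_eq0 sM).
rewrite mulmxBr mulmxBl {1 2}XE linearD /= sU !trmx_mul trmxK mulmxA.
by rewrite opprD addrACA subrr add0r.
Qed.

Lemma lyapunov_psd n (M U X : 'M[R]_n) : stable M -> X = U + M^T *m X *m M ->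
  psd U -> psd X.
Proof.
by move=> sM XE [sU U0]; split; [exact: lyapunov_tr XE sU | exact: lyapunov_ge0 XE U0].
Qed.

(** The operators X |-> X - M^T X M and S |-> S - M S M^T are adjoint. *)
Lemma lyapunov_duality n (M Y H V U : 'M[R]_n) :
  Y = H + M^T *m Y *m M -> V = U + M *m V *m M^T -> \tr (H *m V) = \tr (Y *m U).
Proof.
move=> YE VE.
have -> : H = Y - M^T *m Y *m M by rewrite {1}YE addrK.
have -> : U = V - M *m V *m M^T by rewrite {1}VE addrK.
rewrite mulmxBl mulmxBr !raddfB /=; congr (_ - _).
by rewrite -!mulmxA mxtrace_mulC !mulmxA.
Qed.

End Lyapunov.

(** * Sums along trajectories and expectations *)

Section Trajectories.
Context {R : realType}.

Lemma spectral_radius_lt1_stable_trmx n (M : 'M[R]_n) :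
  spectral_radius M < 1 -> stable M^T.
Proof.
move=> rho1; apply: eigenvalue_lt1_stable => z.
rewrite -map_trmx eigenvalue_trmx => /eigenvalue_normc_le.
by move=> /le_lt_trans; apply.
Qed.

Lemma correlation_solution n (M X0 : 'M[R]_n) : spectral_radius M < 1 ->
  exists S, S = X0 + M *m S *m M^T.
Proof.
move=> /spectral_radius_lt1_stable_trmx /(lyapunov_solution X0).
by rewrite trmxK.
Qed.

Lemma correlation_psd n (M X0 S : 'M[R]_n) : spectral_radius M < 1 ->
  S = X0 + M *m S *m M^T -> psd X0 -> psd S.
Proof.
move=> /spectral_radius_lt1_stable_trmx sM SE.
by apply: (lyapunov_psd sM); rewrite trmxK.
Qed.

(** The partial sums telescope. In particular the sum is a quadratic form of the
    initial state with a fixed matrix, so that sum and expectation never have to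
    be exchanged. *)
Lemma trajectory_series n (M W X : 'M[R]_n) (x : 'cV_n) :
  stable M -> X = W + M^T *m X *m M ->
  (\sum_(0 <= t <oo)
     (((iter t (mulmx M) x)^T *m W *m iter t (mulmx M) x) 0 0)%:E)%E =
  (qform X x)%:E.
Proof.
move=> sM XE; apply: cvg_lim => //.
have step (y : 'cV_n) : qform X y = qform W y + qform X (M *m y).
  by rewrite {1}XE qformD qform_congr.
rewrite (_ : (fun k => _) =
  EFin \o (fun k => qform X x - qform X (iter k (mulmx M) x))); last first.
  apply/funext => k /=; rewrite sumEFin; congr EFin.
  elim: k => [|k IH]; first by rewrite big_geq // subrr.
  rewrite big_nat_recr //= IH -trace_mx11 -mulmxA -/(inner _ _) -/(qform _ _).
  by rewrite (step (iter k _ _)); ring.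
apply: cvg_EFin; first exact: nearW.
rewrite -[X in _ --> X]subr0; apply: cvgB; first exact: cvg_cst.
exact: stable_inner_cvg0.
Qed.

End Trajectories.

Section Expectation.
Context {R : realType} {dsp : measure_display} {T : measurableType dsp}.
Variables (P : probability T R) (n : nat) (x0 : 'I_n -> {RV P >-> R}).
Hypothesis x0_moment : forall i, P.-integrable setT (fun w => (x0 i w ^+ 2)%:E).

Lemma integrable_product i j :
  P.-integrable setT (fun w => (x0 i w * x0 j w)%:E).
Proof.
apply: (@le_integrable _ _ _ _ _ measurableT _
    (fun w => (x0 i w ^+ 2)%:E + (x0 j w ^+ 2)%:E)%E).
- by apply/measurable_EFinP/measurable_funM; exact: measurable_funPT.
- move=> w _; rewrite -EFinD !abse_EFin lee_fin normrM.
  rewrite [leRHS]ger0_norm ?addr_ge0 ?sqr_ge0 //.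
  rewrite -(real_normK (num_real (x0 i w))) -(real_normK (num_real (x0 j w))).
  have := sqr_ge0 (`|x0 i w| - `|x0 j w|).
  have := normr_ge0 (x0 i w); have := normr_ge0 (x0 j w).
  by move=> *; nra.
- by apply: integrableD.
Qed.

Lemma second_momentE i j :
  (\int[P]_w (x0 i w * x0 j w)%:E)%E = (second_moment x0 i j)%:E.
Proof.
rewrite mxE unlock; under [in RHS]eq_integral.
  by move=> w _; rewrite mxE big_ord1 !mxE; over.
rewrite fineK //; apply: integrable_fin_num => //; exact: integrable_product.
Qed.

Lemma second_moment_sym : (second_moment x0)^T = second_moment x0.
Proof.
apply/matrixP => i j; rewrite mxE; apply: EFin_inj; rewrite -!second_momentE.
by apply: eq_integral => w _; rewrite mulrC.
Qed.

Lemma expectation_qform (S : 'M[R]_n) :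
  (\int[P]_w (qform S (initial_state x0 w))%:E)%E = (\tr (S *m second_moment x0))%:E.
Proof.
have qE w : (qform S (initial_state x0 w))%:E =
    (\sum_(i < n) \sum_(j < n) (S i j)%:E * (x0 i w * x0 j w)%:E)%E.
  rewrite /qform innerE -sumEFin; apply: eq_bigr => i _.
  rewrite big_ord1 2!mxE mulr_sumr -sumEFin; apply: eq_bigr => j _.
  by rewrite mxE mulrCA.
have int1 i j : P.-integrable setT (fun w => (S i j)%:E * (x0 i w * x0 j w)%:E)%E.
  by apply: integrableZl => //; exact: integrable_product.
rewrite (eq_integral _ _ (fun w _ => qE w)).
rewrite integral_sum // => [|i]; last exact: integrable_sum.
rewrite /mxtrace -sumEFin; apply: eq_bigr => i _.
rewrite integral_sum // mxE -sumEFin; apply: eq_bigr => j _.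
rewrite integralZl //; last exact: integrable_product.
rewrite second_momentE -EFinM -{1}second_moment_sym.
by congr (_ * _)%:E; rewrite [LHS]mxE.
Qed.

End Expectation.

(** * The cost as a trace *)

Section CostFormulas.
Context {R : realType} {dsp : measure_display} {T : measurableType dsp}.
Variables (P : probability T R) (n : nat) (x0 : 'I_n -> {RV P >-> R}).
Hypothesis x0_moment : forall i, P.-integrable setT (fun w => (x0 i w ^+ 2)%:E).

Lemma second_moment_psd : psd (second_moment x0).
Proof.
split; first exact: second_moment_sym.
move=> x; rewrite -lee_fin.
have -> : qform (second_moment x0) x = \tr (x *m x^T *m second_moment x0).
  by rewrite /qform /inner -mulmxA [RHS]mxtrace_mulC mulmxA.
rewrite -expectation_qform //; apply: integral_ge0 => w _; rewrite lee_fin.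
exact: qform_psd_ge0 (psd_rank1 x).
Qed.

Lemma quadratic_costE (M W X : 'M[R]_n) : stable M -> X = W + M^T *m X *m M ->
  quadratic_cost x0 M W = \tr (X *m second_moment x0).
Proof.
move=> sM XE; rewrite /quadratic_cost.
under eq_integral do rewrite (trajectory_series _ sM XE).
by rewrite expectation_qform.
Qed.

(** The (i, j) entry of the state correlation is the cost for the weight
    e_i e_j^T, which duality turns into the trace of e_i e_j^T S. *)
Lemma state_correlationE m d (A : 'M[R]_n) (B : 'M[R]_(n, m)) (C : 'M[R]_(d, n))
    K (S : 'M[R]_n) :
  feasible A B C K ->
  S = second_moment x0 + (A - B *m K *m C) *m S *m (A - B *m K *m C)^T ->
  state_correlation x0 A B C K = S.
Proof.
move=> fK SE; apply/matrixP => i j; rewrite mxE.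
have sM := spectral_radius_lt1_stable fK; set M := A - _ in sM SE *.
have [X XE] := lyapunov_solution (delta_mx i j) sM.
have <- : \tr (delta_mx i j *m S) = S i j.
  rewrite -[S in RHS](lyapunov_tr (M := M^T) (U := second_moment x0)).
  - by rewrite [RHS]mxE -inner_delta /inner trmx_delta mulmxA
       [RHS]mxtrace_mulC mulmxA mul_delta_mx.
  - exact: spectral_radius_lt1_stable_trmx.
  - by rewrite trmxK.
  - exact: second_moment_sym.
rewrite (lyapunov_duality XE SE) -(quadratic_costE sM XE) /quadratic_cost.
congr fine; apply: eq_integral => w _; congr (limn _); apply/funext => k.
apply: eq_bigr => t _; congr (_ %:E); rewrite -/M.
rewrite /state; move: (iter t _ _) => x.
rewrite -(mul_delta_mx (0 : 'I_1)) mulmxA -colE -mulmxA -rowE.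
by rewrite !mxE !big_ord1 !mxE.
Qed.

End CostFormulas.

(** * Perturbation of the feedback gain *)

Section Perturbation.
Context {R : realType}.
Variables (n m d : nat) (A : 'M[R]_n) (B : 'M[R]_(n, m)) (C : 'M[R]_(d, n)).
Variables (Q : 'M[R]_n) (Rw : 'M[R]_m) (X0 : 'M[R]_n).
Hypotheses (Q_psd : psd Q) (Rw_psd : psd Rw) (X0_psd : psd X0).

Definition closed_loop (K : 'M[R]_(m, d)) : 'M[R]_n := A - B *m K *m C.

Definition running_weight (K : 'M[R]_(m, d)) : 'M[R]_n :=
  Q + C^T *m K^T *m Rw *m K *m C.

(** V is the cost-to-go matrix P_K: the cost from x is the form of V at x. *)
Definition value_matrix (K : 'M[R]_(m, d)) (V : 'M[R]_n) : Prop :=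
  V = running_weight K + (closed_loop K)^T *m V *m closed_loop K.

Definition correlation_matrix (K : 'M[R]_(m, d)) (S : 'M[R]_n) : Prop :=
  S = X0 + closed_loop K *m S *m (closed_loop K)^T.

(** Half the derivative, with respect to a correction of the input at x, of
    the stage cost plus the cost-to-go is the image of x under this matrix. *)
Definition advantage (K : 'M[R]_(m, d)) (V : 'M[R]_n) : 'M[R]_(m, n) :=
  Rw *m K *m C - B^T *m V *m closed_loop K.

Definition cost_gradient (K : 'M[R]_(m, d)) (V S : 'M[R]_n) : 'M[R]_(m, d) :=
  2 *: (advantage K V *m S *m C^T).

(** The parts of degree 1 and 2 in E of the defect
    W_(K+E) + M_(K+E)^T V M_(K+E) - V; see qform_perturbed_value. *)
Definition first_order_form (K E : 'M[R]_(m, d)) (V : 'M[R]_n) : 'M[R]_n :=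
  (E *m C)^T *m advantage K V + ((E *m C)^T *m advantage K V)^T.

Definition second_order_form (E : 'M[R]_(m, d)) (V : 'M[R]_n) : 'M[R]_n :=
  (E *m C)^T *m (Rw + B^T *m V *m B) *m (E *m C).

Lemma qform_running_weight q K (x : 'M[R]_(n, q)) :
  qform (running_weight K) x = qform Q x + qform Rw (K *m C *m x).
Proof.
rewrite /running_weight qformD -qform_congr trmx_mul !mulmxA.
by [].
Qed.

Lemma running_weight_psd K : psd (running_weight K).
Proof.
case: Q_psd => sQ Q0; case: Rw_psd => sR R0; split.
  by rewrite /running_weight linearD /= sQ !trmx_mul !trmxK sR !mulmxA.
by move=> x; rewrite qform_running_weight addr_ge0.
Qed.

Lemma qform_value_matrix q K V (x : 'M[R]_(n, q)) : value_matrix K V ->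
  qform V x = qform Q x + qform Rw (K *m C *m x) + qform V (closed_loop K *m x).
Proof. by move=> VE; rewrite {1}VE qformD qform_congr qform_running_weight. Qed.

Lemma closed_loopD K E (x : 'cV_n) :
  closed_loop (K + E) *m x = closed_loop K *m x - B *m (E *m C *m x).
Proof.
by rewrite /closed_loop mulmxDr mulmxDl opprD addrA mulmxBl !mulmxA.
Qed.

Lemma qform_first_order_advantage K E V (x : 'cV_n) :
  qform (first_order_form K E V) x = 2 * inner (E *m C *m x) (advantage K V *m x).
Proof.
rewrite /first_order_form qformD qform_tr /qform -!mulmxA -inner_mull !mulmxA.
by ring.
Qed.

Lemma qform_first_order K E V (x : 'cV_n) :
  qform (first_order_form K E V) x =
  2 * (inner (E *m C *m x) (Rw *m (K *m C *m x)) -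
       inner (B *m (E *m C *m x)) (V *m (closed_loop K *m x))).
Proof.
rewrite qform_first_order_advantage /advantage mulmxBl innerBr.
by rewrite [inner (B *m _) _]inner_mull !mulmxA.
Qed.

Lemma qform_second_order E V (x : 'cV_n) :
  qform (second_order_form E V) x =
  qform Rw (E *m C *m x) + qform V (B *m (E *m C *m x)).
Proof. by rewrite /second_order_form qform_congr qformD qform_congr. Qed.

Lemma qform_perturbed_value K E V (x : 'cV_n) : value_matrix K V -> V^T = V ->
  qform (running_weight (K + E)) x + qform V (closed_loop (K + E) *m x) =
  qform V x + qform (first_order_form K E V) x + qform (second_order_form E V) x.
Proof.
move=> VE sV; have sR : Rw^T = Rw by case: Rw_psd.
rewrite (qform_value_matrix x VE) qform_first_order qform_second_order.
rewrite qform_running_weight closed_loopD mulmxDl mulmxDl -[- (B *m _)]scaleN1r.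
rewrite !qformDr // qformZr -!scalemxAr innerZr.
rewrite [inner (K *m C *m x) _]inner_selfadjoint // [inner (closed_loop K *m x) _]inner_selfadjoint //.
by ring.
Qed.

(** The new correlation matrix weighs the defect of the old value matrix in the
    new Lyapunov equation, by duality; no approximation is involved. *)
Lemma cost_difference K E V V' S' : value_matrix K V -> V^T = V -> psd S' ->
  value_matrix (K + E) V' -> correlation_matrix (K + E) S' ->
  \tr (V' *m X0) - \tr (V *m X0) =
  \tr (first_order_form K E V *m S') + \tr (second_order_form E V *m S').
Proof.
move=> VE sV pS' V'E S'E.
have := lyapunov_duality (Y := V)
  (H := V - (closed_loop (K + E))^T *m V *m closed_loop (K + E)) (esym (subrK _ _)) S'E.
rewrite -(lyapunov_duality V'E S'E) => <-.
rewrite -linearB -mulmxBl -linearD -mulmxDl; apply: trace_psd_eq => // x.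
have := qform_perturbed_value E x VE sV.
rewrite qformB [qform (V - _) x]qformB [qform (_ *m closed_loop _) x]qform_congr.
by rewrite [qform (first_order_form _ _ _ + _) x]qformD; lra.
Qed.

(** This is the differential of the cost: replace S' by S in the first-order
    term of cost_difference. *)
Lemma trace_first_order K E V S : S^T = S ->
  \tr (first_order_form K E V *m S) = inner (cost_gradient K V S) E.
Proof.
move=> sS; rewrite /first_order_form mulmxDl linearD /=.
have -> : \tr (((E *m C)^T *m advantage K V)^T *m S) = \tr ((E *m C)^T *m advantage K V *m S).
  by rewrite -mxtrace_tr trmx_mul trmxK sS mxtrace_mulC.
rewrite /cost_gradient innerZl mulr_natl mulr2n inner_sym.
by congr (_ + _); rewrite /inner trmx_mul -!mulmxA mxtrace_mulC !mulmxA.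
Qed.

Section Estimates.
Variables (p s b c r : R).
Hypotheses (s_gt0 : 0 < s) (b_gt0 : 0 < b) (c_gt0 : 0 < c) (r_ge0 : 0 <= r).
Hypothesis p_ge0 : 0 <= p.
Hypothesis Q_ge : forall x : 'cV_n, s * inner x x <= qform Q x.
Hypothesis Rw_le : forall x : 'cV_m, qform Rw x <= r * inner x x.
Hypothesis B_le : forall x : 'cV_m, inner (B *m x) (B *m x) <= b ^+ 2 * inner x x.
Hypothesis C_le : forall x : 'cV_n, inner (C *m x) (C *m x) <= c ^+ 2 * inner x x.

(** The constant zeta_1: the derivative P' of the value matrix in a unit
    direction satisfies - zeta P <= P' <= zeta P. The parameters will be
    p = alpha / mu, s = sigma_min Q, b = |B|, c = |C| and r = |R|. *)
Definition growth_factor : R := s^-1 * ((1 + c ^+ 2 * b ^+ 2) * p + c ^+ 2 * r) - 1.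
Local Notation zeta := growth_factor.
Hypothesis zeta_ge0 : 0 <= zeta.

Variables (K E : 'M[R]_(m, d)) (V : 'M[R]_n) (e : R).
Hypothesis K_stable : stable (closed_loop K).
Hypothesis VE : value_matrix K V.
Hypothesis V_le : forall x : 'cV_n, qform V x <= p * inner x x.
Hypotheses (e_gt0 : 0 < e) (E_le : inner E E <= e ^+ 2).

Lemma value_psd : psd V.
Proof. exact: lyapunov_psd K_stable VE (running_weight_psd K). Qed.

Lemma input_le (x : 'cV_n) :
  inner (E *m C *m x) (E *m C *m x) <= (c * e) ^+ 2 * inner x x.
Proof.
rewrite -mulmxA; apply: le_trans (inner_mul_le _ _) _.
apply: (@le_trans _ _ (e ^+ 2 * (c ^+ 2 * inner x x))); last first.
  by rewrite exprMn mulrA [e ^+ 2 * _]mulrC.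
by apply: ler_pM => //; rewrite inner_ge0.
Qed.

Lemma pushed_input_le (x : 'cV_n) :
  inner (B *m (E *m C *m x)) (B *m (E *m C *m x)) <= (b * c * e) ^+ 2 * inner x x.
Proof.
apply: le_trans (B_le _) _.
have -> : (b * c * e) ^+ 2 * inner x x = b ^+ 2 * ((c * e) ^+ 2 * inner x x) by ring.
by rewrite ler_wpM2l ?sqr_ge0 // input_le.
Qed.

Lemma second_order_le (x : 'cV_n) :
  qform (second_order_form E V) x <= (r + b ^+ 2 * p) * (c * e) ^+ 2 * inner x x.
Proof.
rewrite qform_second_order mulrDl mulrDl lerD //.
  by apply: le_trans (Rw_le _) _; rewrite -mulrA ler_wpM2l // input_le.
apply: le_trans (V_le _) _.
have -> : b ^+ 2 * p * (c * e) ^+ 2 * inner x x = p * ((b * c * e) ^+ 2 * inner x x) by ring.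
by rewrite ler_wpM2l // pushed_input_le.
Qed.

Lemma second_order_ge0 (x : 'cV_n) : 0 <= qform (second_order_form E V) x.
Proof.
rewrite qform_second_order addr_ge0 //; apply: qform_psd_ge0 => //; exact: value_psd.
Qed.

(** Young's inequality with weight e on the terms along the unperturbed
    trajectory, whose sum is the form of V minus that of Q by the Lyapunov
    equation, and with weight 1 / e on those quadratic in E. The term
    - Q is the origin of the summand - 1 in zeta. *)
Lemma first_order_le (x : 'cV_n) :
  `|qform (first_order_form K E V) x| <= e * zeta * qform Q x.
Proof.
have ei0 : 0 < e^-1 by rewrite invr_gt0.
set z := E *m C *m x; set y := K *m C *m x; set w := closed_loop K *m x; set v := B *m z.
have vx := qform_value_matrix x VE; rewrite -/y -/w in vx.
have R1 : e^-1 * qform Rw z <= e * (r * c ^+ 2 * inner x x).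
  rewrite -(ler_pM2l e_gt0) mulVKf ?lt0r_neq0 //; apply: le_trans (Rw_le _) _.
  have -> : e * (e * (r * c ^+ 2 * inner x x)) = r * ((c * e) ^+ 2 * inner x x) by ring.
  by rewrite ler_wpM2l // input_le.
have V1 : e^-1 * qform V v <= e * (p * b ^+ 2 * c ^+ 2 * inner x x).
  rewrite -(ler_pM2l e_gt0) mulVKf ?lt0r_neq0 //; apply: le_trans (V_le _) _.
  have -> : e * (e * (p * b ^+ 2 * c ^+ 2 * inner x x)) =
      p * ((b * c * e) ^+ 2 * inner x x) by ring.
  by rewrite ler_wpM2l // pushed_input_le.
have VW : e * qform Rw y + e * qform V w <= e * (p * inner x x) - e * qform Q x.
  by rewrite -mulrDr -mulrBr; apply: (ler_wpM2l (ltW e_gt0)); have := V_le x; lra.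
have tot : e * (r * c ^+ 2 * inner x x) + e * (p * b ^+ 2 * c ^+ 2 * inner x x) +
    e * (p * inner x x) - e * qform Q x <= e * zeta * qform Q x.
  rewrite [leLHS](_ : _ = e * ((r * c ^+ 2 + p * b ^+ 2 * c ^+ 2 + p) * inner x x -
    qform Q x)); last by ring.
  rewrite -[leRHS]mulrA; apply: (ler_wpM2l (ltW e_gt0)).
  rewrite /growth_factor mulrBl mul1r lerD2r.
  have -> : (r * c ^+ 2 + p * b ^+ 2 * c ^+ 2 + p) * inner x x =
     (s^-1 * ((1 + c ^+ 2 * b ^+ 2) * p + c ^+ 2 * r)) * (s * inner x x).
    by field; rewrite lt0r_neq0.
  apply: ler_wpM2l (Q_ge x); apply: mulr_ge0; first by rewrite invr_ge0 ltW.
  by apply: addr_ge0; apply: mulr_ge0; rewrite ?sqr_ge0 // addr_ge0 // mulr_ge0 ?sqr_ge0.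
have yR t := psd_young (t *: z) y Rw_psd ei0; have yV t := psd_young (t *: v) w value_psd ei0.
have := yR 1; have := yR (-1); have := yV 1; have := yV (-1).
rewrite !qformZr !innerZl invrK sqrrN expr1n !mul1r !mulN1r qform_first_order.
rewrite -/z -/y -/w -/v => H1 H2 H3 H4.
by rewrite ler_norml; apply/andP; split; lra.
Qed.

Lemma first_order_sym : (first_order_form K E V)^T = first_order_form K E V.
Proof. by rewrite /first_order_form linearD /= trmxK addrC. Qed.

(** Y is the derivative of the value matrix in direction E. Since the form of H
    is at most e zeta Q <= e zeta W_K, comparison of Lyapunov equations gives the
    bound e zeta V for Y, and V <= p. *)
Lemma first_order_corrector : exists Y : 'M[R]_n,
  [/\ Y^T = Y, Y = first_order_form K E V + (closed_loop K)^T *m Y *m closed_loop K &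
      forall x : 'cV_n, `|qform Y x| <= e * zeta * p * inner x x].
Proof.
have [Y YE] := lyapunov_solution (first_order_form K E V) K_stable.
exists Y; split=> //; first exact: lyapunov_tr K_stable YE first_order_sym.
move=> x; apply: (@le_trans _ _ (e * zeta * qform V x)); last first.
  by rewrite -[leRHS]mulrA ler_wpM2l // mulr_ge0 // ltW.
have ez : 0 <= e * zeta by rewrite mulr_ge0 // ltW.
have W_ge (y : 'cV_n) : e * zeta * qform Q y <= e * zeta * qform (running_weight K) y.
  rewrite ler_wpM2l // qform_running_weight lerDl.
  exact: qform_psd_ge0.
have comb t : t *: Y + (e * zeta) *: V =
    (t *: first_order_form K E V + (e * zeta) *: running_weight K) +
    (closed_loop K)^T *m (t *: Y + (e * zeta) *: V) *m closed_loop K.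
  exact: lyapunov_lincomb YE VE.
have pos t : t = 1 \/ t = -1 -> 0 <= qform (t *: Y + (e * zeta) *: V) x.
  move=> t1; apply: (lyapunov_ge0 K_stable (comb t)) => y.
  rewrite qformD !qformZ; have := first_order_le y; have := W_ge y.
  by rewrite ler_norml => ? /andP[]; case: t1 => ->; lra.
have := pos 1 (or_introl erefl); have := pos (-1) (or_intror erefl).
by rewrite !qformD !qformZ ler_norml => ? ?; apply/andP; split; lra.
Qed.

(** Half the Lipschitz constant of the gradient, up to the factor tr S'. *)
Definition smoothness : R := (r + b ^+ 2 * p) * c ^+ 2 + 2 * (zeta * p * b * c).
Definition cubic_constant : R := zeta * p * b ^+ 2 * c ^+ 2.

(** Beyond the second-order term tr (F S'), the error is tr (H (S' - S)). By
    duality through Y it equals the trace against S' alone of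
    M'^T Y M' - M^T Y M, which contains the factor M' - M = - B E C besides Y,
    itself linear in E, and is thus of second order. *)
Lemma cost_remainder V' S S' : psd S -> psd S' ->
  correlation_matrix K S -> correlation_matrix (K + E) S' -> value_matrix (K + E) V' ->
  `|\tr (V' *m X0) - \tr (V *m X0) - inner (cost_gradient K V S) E| <=
  (smoothness * e ^+ 2 + cubic_constant * e ^+ 3) * \tr S'.
Proof.
move=> pS pS' SE S'E V'E; have [sS _] := pS.
have [sV _] := value_psd.
rewrite (cost_difference VE sV pS' V'E S'E) -(trace_first_order K E V sS).
have [Y [sY YE Y_le]] := first_order_corrector.
set M' := closed_loop (K + E).
set U := M'^T *m Y *m M' - (closed_loop K)^T *m Y *m closed_loop K.
have -> : \tr (first_order_form K E V *m S) =
    \tr (first_order_form K E V *m S') - \tr (U *m S').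
  have -> : U = (Y - (closed_loop K)^T *m Y *m closed_loop K) - (Y - M'^T *m Y *m M').
    by rewrite opprB [RHS]addrC addrA subrK.
  have <- : first_order_form K E V = Y - (closed_loop K)^T *m Y *m closed_loop K.
    by rewrite {1}YE addrK.
  rewrite mulmxBl linearB /= opprB addrC subrK.
  by rewrite (lyapunov_duality YE SE) (lyapunov_duality (esym (subrK _ _)) S'E).
rewrite [X in `|X|](_ : _ = \tr (second_order_form E V *m S') + \tr (U *m S')); last by ring.
have trS' : \tr (M'^T *m M' *m S') <= \tr S'.
  have -> : \tr (M'^T *m M' *m S') = \tr (M' *m S' *m M'^T).
    by rewrite -mulmxA mxtrace_mulC.
  rewrite [X in _ <= \tr X]S'E mxtraceD -/M'.
  by rewrite lerDr -[X0]mul1mx; apply: trace_psd_ge0 => // x; rewrite qform1 inner_ge0.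
(* The weight th = |B| |C| e bounds the norm of B E C, which balances the two
   terms of the bilinear bound. *)
set th := b * c * e; have th0 : 0 < th by rewrite !mulr_gt0.
set k := e * zeta * p; have k0 : 0 <= k by rewrite !mulr_ge0 // ltW.
have U_le (x : 'cV_n) :
    `|qform U x| <= k * (th * (inner (M' *m x) (M' *m x) + inner x x) + th ^+ 2 * inner x x).
  set v := B *m (E *m C *m x); set u := M' *m x.
  have -> : qform U x = - (2 * inner u (Y *m v)) - qform Y v.
    rewrite /U qformB !qform_congr -/u.
    have -> : closed_loop K *m x = u + v by rewrite /u /M' closed_loopD subrK.
    by rewrite qformDr //; ring.
  have v_le := pushed_input_le x; rewrite -/v -/th in v_le.
  apply: le_trans (ler_normB _ _) _; rewrite normrN mulrDr; apply: lerD.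
    apply: le_trans (bilinear_young u v sY Y_le th0) _.
    rewrite ler_wpM2l // mulrDr lerD2l -(ler_pM2l th0) mulVKf ?lt0r_neq0 //.
    by rewrite mulrA -expr2.
  by apply: le_trans (Y_le v) _; rewrite ler_wpM2l.
have U_tr : `|\tr (U *m S')| <= k * (2 * th + th ^+ 2) * \tr S'.
  pose D := (k * th) *: (M'^T *m M') + (k * (th + th ^+ 2)) *: 1%:M.
  have D_tr : \tr (D *m S') <= k * (2 * th + th ^+ 2) * \tr S'.
    rewrite mulmxDl linearD /= -!scalemxAl !mxtraceZ mul1mx.
    have : k * th * \tr (M'^T *m M' *m S') <= k * th * \tr S'.
      by rewrite ler_wpM2l // mulr_ge0 // ltW.
    by move=> *; lra.
  apply: le_trans D_tr; have DE (x : 'cV_n) : qform D x =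
      k * (th * (inner (M' *m x) (M' *m x) + inner x x) + th ^+ 2 * inner x x).
    by rewrite /D qformD !qformZ qform1 qform_gram; ring.
  rewrite ler_norml; apply/andP; split.
    rewrite lerNl -linearN -mulNmx; apply: trace_psd_le => // x.
    by rewrite qformN DE; apply: le_trans (U_le x); rewrite -normrN ler_norm.
  by apply: trace_psd_le => // x; rewrite DE; apply: le_trans (U_le x); rewrite ler_norm.
have F_tr : `|\tr (second_order_form E V *m S')| <= (r + b ^+ 2 * p) * (c * e) ^+ 2 * \tr S'.
  rewrite ger0_norm; last by apply: trace_psd_ge0 => // x; exact: second_order_ge0.
  rewrite -mxtraceZ -mul_scalar_mx; apply: trace_psd_le => // x.
  by rewrite -scalemx1 qformZ qform1; exact: second_order_le.
apply: le_trans (ler_normD _ _) _; apply: le_trans (lerD F_tr U_tr) _.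
rewrite le_eqVlt; apply/orP; left; apply/eqP.
by rewrite /k /th /smoothness /cubic_constant; ring.
Qed.

(** Bound on the defect of V for K + E relative to the running cost. *)
Definition drift : R := zeta * e + (r + b ^+ 2 * p) * c ^+ 2 / s * e ^+ 2.

Lemma quadratic_drift_ge0 : 0 <= (r + b ^+ 2 * p) * c ^+ 2 / s * e ^+ 2.
Proof.
have h : 0 <= r + b ^+ 2 * p by rewrite addr_ge0 // mulr_ge0 ?sqr_ge0.
by rewrite mulr_ge0 ?sqr_ge0 // divr_ge0 ?(ltW s_gt0) // mulr_ge0 ?sqr_ge0.
Qed.

Lemma drift_ge0 : 0 <= drift.
Proof.
rewrite /drift; apply: addr_ge0; first by rewrite mulr_ge0 // ltW.
exact: quadratic_drift_ge0.
Qed.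

Lemma perturbed_decrease (x : 'cV_n) :
  (1 - drift) * qform (running_weight (K + E)) x <=
  qform V x - qform V (closed_loop (K + E) *m x).
Proof.
have [sV _] := value_psd.
have := qform_perturbed_value E x VE sV; have := first_order_le x.
rewrite ler_norml => /andP[_ H1 H2].
have F1 : qform (second_order_form E V) x <= (r + b ^+ 2 * p) * c ^+ 2 / s * e ^+ 2 * qform Q x.
  apply: le_trans (second_order_le x) _.
  rewrite [leLHS](_ : _ = (r + b ^+ 2 * p) * c ^+ 2 / s * e ^+ 2 * (s * inner x x)); last first.
    by field; rewrite lt0r_neq0.
  exact: ler_wpM2l quadratic_drift_ge0 _ _ (Q_ge x).
have W1 : drift * qform Q x <= drift * qform (running_weight (K + E)) x.
  rewrite ler_wpM2l ?drift_ge0 // qform_running_weight lerDl.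
  exact: qform_psd_ge0.
have D1 : drift * qform Q x = e * zeta * qform Q x +
    (r + b ^+ 2 * p) * c ^+ 2 / s * e ^+ 2 * qform Q x by rewrite /drift; ring.
by lra.
Qed.

(** V remains a Lyapunov function for K + E. *)
Lemma perturbed_feasible : drift < 1 -> spectral_radius (closed_loop (K + E)) < 1.
Proof.
rewrite -subr_gt0 => d1; have ds : 0 < (1 - drift) * s by rewrite mulr_gt0.
apply: (lyapunov_spectral_radius_lt1 ds value_psd) => x.
apply: le_trans (perturbed_decrease x); rewrite -mulrA ler_pM2l //.
apply: le_trans (Q_ge x) _; rewrite qform_running_weight lerDl.
exact: qform_psd_ge0.
Qed.

Lemma perturbed_cost_le V' : drift < 1 -> value_matrix (K + E) V' ->
  (1 - drift) * \tr (V' *m X0) <= \tr (V *m X0).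
Proof.
move=> d1 V'E; have sM' := spectral_radius_lt1_stable (perturbed_feasible d1).
rewrite -mxtraceZ scalemxAl; apply: trace_psd_le => // x.
set M' := closed_loop (K + E) in sM'.
have UE := lyapunov_lincomb 1 (- (1 - drift)) (esym (subrK (M'^T *m V *m M') V)) V'E.
rewrite -subr_ge0 -qformB; have ge0 := lyapunov_ge0 sM' UE.
rewrite !scale1r !scaleNr in ge0; apply: ge0 => y.
rewrite qformB [qform (V - _) y]qformB qformZ qform_congr subr_ge0.
exact: perturbed_decrease.
Qed.

End Estimates.

Lemma trace_correlation_le (s : R) K V S : psd S ->
  (forall x : 'cV_n, s * inner x x <= qform Q x) ->
  value_matrix K V -> correlation_matrix K S -> s * \tr S <= \tr (V *m X0).
Proof.
move=> pS Q_ge VE SE; rewrite -(lyapunov_duality VE SE) -mxtraceZ -mul_scalar_mx.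
apply: trace_psd_le => // x; rewrite -scalemx1 qformZ qform1.
apply: le_trans (Q_ge x) _; rewrite qform_running_weight lerDl.
exact: qform_psd_ge0.
Qed.

End Perturbation.

(** * Descent along a segment *)

Section DescentAlongSegment.
Context {R : realType}.

(** Here phi is the function on the segment, psi its derivative, and the two
    expansions are only available from points of the sublevel set. Subdivide
    [0, 1] into N steps of length h. Adding both expansions over a step bounds the
    increase of psi by (lam + 2 kappa h) h; summation gives the quadratic upper
    model at the nodes with error kappa h. Since psi 0 <= - lam the model stays
    below phi 0, so no node leaves the sublevel set and the induction goes on.
    Let N tend to infinity. *)
Lemma segment_descent (phi psi : R -> R) (feas : R -> Prop) (alpha lam kappa delta : R) :
  0 < lam -> 0 <= kappa -> 0 < delta ->
  (forall s t, 0 <= s -> s < t -> t <= 1 -> t - s <= delta -> feas s -> phi s <= alpha ->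
     feas t /\
     phi t <= phi s + psi s * (t - s) + lam / 2 * (t - s) ^+ 2 + kappa * (t - s) ^+ 3) ->
  (forall s t, 0 <= s -> s < t -> t <= 1 -> t - s <= delta ->
     feas s -> phi s <= alpha -> feas t -> phi t <= alpha ->
     phi s <= phi t - psi t * (t - s) + lam / 2 * (t - s) ^+ 2 + kappa * (t - s) ^+ 3) ->
  feas 0 -> phi 0 <= alpha -> psi 0 <= - lam ->
  feas 1 /\ phi 1 <= phi 0 + psi 0 + lam / 2.
Proof.
move=> lam0 kap0 del0 forward backward f0 phi0 psi0.
have main N : delta^-1 + kappa / (lam / 2) < N%:R ->
    feas 1 /\ phi 1 <= phi 0 + psi 0 + lam / 2 + kappa * N%:R^-1.
  move=> hN; have lam2 : 0 < lam / 2 by rewrite divr_gt0.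
  have kl : 0 <= kappa / (lam / 2) by rewrite divr_ge0 // ltW.
  have di : 0 < delta^-1 by rewrite invr_gt0.
  have N0 : 0 < N%:R :> R by lra.
  set h := N%:R^-1; have h0 : 0 < h by rewrite invr_gt0.
  have Nh : N%:R * h = 1 by rewrite mulfV // lt0r_neq0.
  have hdel : h <= delta by rewrite -[delta]invrK lef_pV2 ?posrE //; lra.
  have kh : kappa * h <= lam / 2.
    by rewrite ler_pdivrMr // mulrC -ler_pdivrMr //; lra.
  pose s k : R := k%:R * h.
  have s1 k : s k.+1 = s k + h by rewrite /s -natr1 mulrDl mul1r.
  have claim k : (k <= N)%N -> [/\ feas (s k), phi (s k) <= alpha,
      phi (s k) <= phi 0 + s k * psi 0 + lam / 2 * s k ^+ 2 + kappa * h * s k ^+ 2 &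
      psi (s k) <= psi 0 + s k * (lam + 2 * kappa * h)].
    elim: k => [|k IH] kN.
      by rewrite /s mul0r; split => //; lra.
    have [fk ak pk qk] := IH (ltnW kN).
    have sk0 : 0 <= s k by rewrite mulr_ge0 // ltW.
    have sk1 : s k.+1 <= 1 by rewrite -Nh ler_pM2r // ler_nat.
    have skd : s k.+1 - s k = h by rewrite s1 addrAC subrr add0r.
    have sklt : s k < s k.+1 by rewrite s1 ltrDl.
    have [fk1 pk1] : feas (s k.+1) /\ phi (s k.+1) <=
        phi (s k) + psi (s k) * h + lam / 2 * h ^+ 2 + kappa * h ^+ 3.
      by rewrite -skd; apply: forward; rewrite ?skd.
    have hq : psi (s k) * h <= (psi 0 + s k * (lam + 2 * kappa * h)) * h by rewrite ler_pM2r.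
    have pk2 : phi (s k.+1) <=
        phi 0 + s k.+1 * psi 0 + lam / 2 * s k.+1 ^+ 2 + kappa * h * s k.+1 ^+ 2.
      by apply: le_trans pk1 _; rewrite s1; nra.
    have ak1 : phi (s k.+1) <= alpha.
      apply: le_trans pk2 _; apply: le_trans phi0; rewrite -!addrA gerDl.
      have t0 : 0 <= s k.+1 by apply: le_trans sk0 (ltW sklt).
      rewrite (_ : _ + _ = s k.+1 * (psi 0 + (lam / 2 + kappa * h) * s k.+1)); last by ring.
      rewrite mulr_ge0_le0 //.
      have : (lam / 2 + kappa * h) * s k.+1 <= (lam / 2 + kappa * h) * 1.
        by rewrite ler_wpM2l // addr_ge0 ?mulr_ge0 // ltW.
      by lra.
    split => //.
    have := backward _ _ sk0 sklt sk1; rewrite skd => /(_ hdel fk ak fk1 ak1) bk.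
    have : psi (s k.+1) * h <= (psi (s k) + lam * h + 2 * kappa * h ^+ 2) * h by nra.
    by rewrite ler_pM2r // => H; apply: le_trans H _; rewrite s1; nra.
  have [f1 _ p1 _] := claim N (leqnn N); rewrite /s Nh in f1 p1.
  by split => //; lra.
have [X0 X1] : 0 < delta^-1 /\ 0 <= kappa / (lam / 2).
  by rewrite invr_gt0 divr_ge0 // ltW // divr_gt0.
split.
  by have [] := main _ (archi_boundP (addr_ge0 (ltW X0) X1)).
apply/ler_addgt0Pr => e e0.
have ke : 0 <= kappa / e by rewrite divr_ge0 // ltW.
pose X := delta^-1 + kappa / (lam / 2) + kappa / e.
have X_ge0 : 0 <= X by rewrite !addr_ge0 // ltW.
have XN := archi_boundP X_ge0; set N := Num.bound X in XN.
have XN1 : delta^-1 + kappa / (lam / 2) < N%:R by apply: le_lt_trans XN; rewrite lerDl.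
have [_ H] := main N XN1; apply: le_trans H _; rewrite lerD2l.
have N0 : 0 < N%:R :> R by apply: le_lt_trans XN.
rewrite ler_pdivrMr // mulrC -ler_pdivrMr //; apply: ltW; apply: le_lt_trans XN.
by rewrite lerDr addr_ge0 // ltW.
Qed.

End DescentAlongSegment.

(** * Gradients of functions of a matrix *)

Section Gradient.
Context {R : realType}.

Lemma mx_entry_le p q (E : 'M[R]_(p, q)) i j : `|E i j| <= `|E|.
Proof.
rewrite [leRHS]mx_normrE.
exact: (le_bigmax_cond _ (fun ij : 'I_p * 'I_q => `|E ij.1 ij.2|) (j := (i, j))).
Qed.

Lemma inner_le_mx_norm p q (E : 'M[R]_(p, q)) :
  inner E E <= ((p * q).+1%:R * `|E|) ^+ 2.
Proof.
have n0 := normr_ge0 E; set N := (p * q)%N.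
apply: (@le_trans _ _ (N%:R * `|E| ^+ 2)).
  rewrite innerE; apply: (@le_trans _ _ (\sum_(i < p) \sum_(j < q) `|E| ^+ 2)).
    apply: ler_sum => i _; apply: ler_sum => j _.
    by rewrite -expr2 -real_normK ?num_real // ler_pXn2r ?nnegrE // mx_entry_le.
  by rewrite !sumr_const !card_ord -mulrnA mulr_natl mulnC.
rewrite exprMn ler_wpM2r ?sqr_ge0 //.
by rewrite expr2 -natrM ler_nat (leq_trans (leqnSn N)) // leq_pmulr.
Qed.

Lemma inner_is_linear p q (G : 'M[R]_(p, q)) : linear (inner G : 'M[R]_(p, q) -> R).
Proof. by move=> a U V; rewrite innerDr innerZr. Qed.

HB.instance Definition _ p q (G : 'M[R]_(p, q)) :=
  GRing.isLinear.Build R 'M[R]_(p, q) R _ (inner G) (inner_is_linear G).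

Lemma inner_continuous p q (G : 'M[R]_(p, q)) :
  continuous (inner G : 'M[R]_(p, q) -> R).
Proof.
apply: bounded_linear_continuous.
pose c := \sum_i \sum_j `|G i j|.
have c0 : 0 <= c by apply: sumr_ge0 => i _; apply: sumr_ge0.
have G_le (E : 'M[R]_(p, q)) : `|inner G E| <= c * `|E|.
  rewrite innerE /c mulr_suml; apply: le_trans (ler_norm_sum _ _ _) _; apply: ler_sum => i _.
  rewrite mulr_suml; apply: le_trans (ler_norm_sum _ _ _) _; apply: ler_sum => j _.
  by rewrite normrM ler_wpM2l // mx_entry_le.
exists c; split; first exact: num_real.
move=> M cM; near=> E.
apply: le_trans (G_le E) _; apply: le_trans (ltW cM).
have E1 : `|E| <= 1 by near: E; exact: (@nbhs0_le R 'M[R]_(p, q) _ ltr01).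
by rewrite ler_piMr.
Unshelve. all: by end_near. Qed.

(** A quadratic remainder identifies the differential. The library norm on
    matrices is the max norm, hence the factor N between the two norms. *)
Lemma gradient_unique p q (f : 'M[R]_(p, q) -> R) K G (c delta : R) :
  0 < delta -> 0 < c ->
  (forall E e, 0 < e -> e <= delta -> inner E E <= e ^+ 2 ->
     `|f (K + E) - f K - inner G E| <= c * e ^+ 2) ->
  gradient f K = G.
Proof.
move=> delta0 c0 expansion.
have diffE : 'd f K = inner G :> ('M[R]_(p, q) -> R).
  apply: diff_unique; first exact: inner_continuous.
  apply/eqaddoP => eps eps0; near=> E.
  have [->|E0] := eqVneq E 0.
    rewrite !normr0 mulr0 /= [X in `|X|](_ : _ = f (0 + K) - (f K + inner G 0)) //.
    by rewrite inner0r addr0 add0r subrr normr0.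
  set N : R := (p * q).+1%:R; have N0 : 0 < N by rewrite ltr0n.
  have nE : 0 < `|E| by rewrite normr_gt0.
  rewrite [X in `|X|](_ : _ = f (K + E) - f K - inner G E); last first.
    by rewrite -addrA -opprD [K + E]addrC.
  have Ed : `|E| <= delta / N by near: E; apply: (@nbhs0_le R 'M[R]_(p, q)); rewrite divr_gt0.
  have Ee : `|E| <= eps / (c * N ^+ 2).
    by near: E; apply: (@nbhs0_le R 'M[R]_(p, q)); rewrite divr_gt0 // mulr_gt0 // exprn_gt0.
  have := expansion E (N * `|E|); rewrite inner_le_mx_norm => /(_ _ _ isT) H.
  apply: le_trans (H _ _) _; first by rewrite mulr_gt0.
    by rewrite mulrC -ler_pdivlMr.
  have -> : c * (N * `|E|) ^+ 2 = `|E| * (c * N ^+ 2) * `|E| by ring.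
  by rewrite ler_wpM2r // -ler_pdivlMr // mulr_gt0 // exprn_gt0.
apply/matrixP => i j; rewrite mxE diffE /=.
rewrite /inner -[delta_mx i j](mul_delta_mx (0 : 'I_1)).
by rewrite mulmxA -colE mxtrace_mulC -rowE trace_mx11 !mxE.
Unshelve. all: by end_near. Qed.

End Gradient.

(** * Descent and gradient dominance on a sublevel set *)

Section Descent.
Context {R : realType}.
(** J is an arbitrary function given by the trace formula on stabilizing gains;
    this keeps the analysis independent of the probability space. *)
Variables (n m d : nat) (A : 'M[R]_n) (B : 'M[R]_(n, m)) (C : 'M[R]_(d, n)).
Variables (Q : 'M[R]_n) (Rw : 'M[R]_m) (X0 : 'M[R]_n) (J : 'M[R]_(m, d) -> R).
Hypotheses (Q_psd : psd Q) (Rw_psd : psd Rw) (X0_psd : psd X0).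

Local Notation feas := (feasible A B C).
Local Notation value := (value_matrix A B C Q Rw).
Local Notation corr := (correlation_matrix A B C X0).

Hypothesis JE : forall K V, feas K -> value K V -> J K = \tr (V *m X0).

Lemma feasible_stable K : feas K -> stable (closed_loop A B C K).
Proof. exact: spectral_radius_lt1_stable. Qed.

Lemma feasible_value K : feas K -> exists V, value K V.
Proof. by move=> /feasible_stable; exact: lyapunov_solution. Qed.

Lemma feasible_correlation K : feas K -> exists2 S, corr K S & psd S.
Proof.
move=> fK; have [S SE] := correlation_solution X0 fK; exists S => //.
exact: correlation_psd fK SE X0_psd.
Qed.

Lemma cost_ge0 K : feas K -> 0 <= J K.
Proof.
move=> fK; have [V VE] := feasible_value fK; rewrite (JE fK VE).
apply: trace_psd_ge0; first exact: X0_psd.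
by have [] := lyapunov_psd (feasible_stable fK) VE (running_weight_psd C Q_psd Rw_psd K).
Qed.

(** The form of V is at most tr V, and mu tr V <= tr (V X0). *)
Lemma value_le K V alpha mu : 0 < mu ->
  (forall x : 'cV_n, mu * inner x x <= qform X0 x) ->
  feas K -> value K V -> J K <= alpha ->
  forall x : 'cV_n, qform V x <= alpha / mu * inner x x.
Proof.
move=> mu0 X0_ge fK VE Ja x.
have pV := lyapunov_psd (feasible_stable fK) VE (running_weight_psd C Q_psd Rw_psd K).
apply: le_trans (psd_qform_le_trace x pV) _; rewrite ler_wpM2r ?inner_ge0 //.
rewrite ler_pdivlMr // mulrC; apply: le_trans Ja.
rewrite (JE fK VE) mxtrace_mulC -mxtraceZ -mul_scalar_mx.
apply: trace_psd_le => // y; rewrite -scalemx1 qformZ qform1.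
exact: X0_ge.
Qed.

Section SublevelSet.
Variables alpha mu s b c r : R.
Local Notation p := (alpha / mu).
Hypotheses (n_gt0 : (0 < n)%N) (mu_gt0 : 0 < mu) (s_gt0 : 0 < s) (b_gt0 : 0 < b).
Hypotheses (c_gt0 : 0 < c) (r_ge0 : 0 <= r) (alpha_gt0 : 0 < alpha).
Hypothesis X0_ge : forall x : 'cV_n, mu * inner x x <= qform X0 x.
Hypothesis Q_ge : forall x : 'cV_n, s * inner x x <= qform Q x.
Hypothesis Rw_le : forall x : 'cV_m, qform Rw x <= r * inner x x.
Hypothesis B_le : forall x : 'cV_m, inner (B *m x) (B *m x) <= b ^+ 2 * inner x x.
Hypothesis C_le : forall x : 'cV_n, inner (C *m x) (C *m x) <= c ^+ 2 * inner x x.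

Definition in_sublevel (K : 'M[R]_(m, d)) : Prop := feas K /\ J K <= alpha.
Local Notation sub := in_sublevel.

Let p_ge0 : 0 <= p. Proof. by rewrite divr_ge0 // ltW. Qed.

Local Notation zeta := (growth_factor p s b c r).
Local Notation sm := (smoothness p s b c r).
Local Notation cub := (cubic_constant p s b c r).
Local Notation a4 := ((r + b ^+ 2 * p) * c ^+ 2 / s).

(** s <= Q <= V <= p in the order of quadratic forms. *)
Lemma growth_factor_ge0 K : sub K -> 0 <= zeta.
Proof.
move=> [fK Ja]; have [V VE] := feasible_value fK.
have V_le := value_le mu_gt0 X0_ge fK VE Ja.
pose x : 'cV[R]_n := delta_mx (Ordinal n_gt0) 0.
have x1 : inner x x = 1 by rewrite /inner trmx_delta mul_delta_mx trace_mx11 mxE.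
have sp : s <= p.
  have := V_le x; rewrite (qform_value_matrix x VE) x1 mulr1.
  have := Q_ge x; rewrite x1 mulr1.
  have : 0 <= qform Rw (K *m C *m x) by exact: qform_psd_ge0.
  have : 0 <= qform V (closed_loop A B C K *m x).
    apply: qform_psd_ge0.
    exact: lyapunov_psd (feasible_stable fK) VE (running_weight_psd C Q_psd Rw_psd K).
  by move=> *; lra.
rewrite /growth_factor subr_ge0 mulrC ler_pdivlMr // mul1r; apply: le_trans sp _.
by rewrite mulrDl mul1r -addrA lerDl addr_ge0 // mulr_ge0 ?sqr_ge0 // mulr_ge0 ?sqr_ge0.
Qed.

(** The remainder of cost_remainder is controlled by tr S' <= J (K + E) / s, and
    J (K + E) <= alpha / (1 - drift) = alpha (1 + O (e)), so that the constant of
    e^2 is not spoilt. The radius delta is uniform, which replaces the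
    compactness of the sublevel set. *)
Lemma sublevel_expansion : (exists K, sub K) -> exists delta kappa : R,
  [/\ 0 < delta, 0 <= kappa & forall K E e V S, sub K -> 0 < e -> e <= delta ->
    inner E E <= e ^+ 2 -> value K V -> corr K S ->
    feas (K + E) /\
    `|J (K + E) - J K - inner (cost_gradient A B C Rw K V S) E| <=
      sm * alpha / s * e ^+ 2 + kappa * e ^+ 3].
Proof.
move=> [K1 /growth_factor_ge0 zeta_ge0].
have h1 : 0 <= r + b ^+ 2 * p by rewrite addr_ge0 // mulr_ge0 ?sqr_ge0.
have a4_ge0 : 0 <= a4 by rewrite divr_ge0 ?(ltW s_gt0) // mulr_ge0 ?sqr_ge0.
have sm_ge0 : 0 <= sm.
  apply: addr_ge0; apply: mulr_ge0; rewrite ?sqr_ge0 //.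
  exact: mulr_ge0 (mulr_ge0 (mulr_ge0 zeta_ge0 p_ge0) (ltW b_gt0)) (ltW c_gt0).
have cub_ge0 : 0 <= cub.
  exact: mulr_ge0 (mulr_ge0 (mulr_ge0 zeta_ge0 p_ge0) (sqr_ge0 _)) (sqr_ge0 _).
(* drift <= c3 e for e <= 1, and the choice of delta makes it at most 1/2. *)
pose c3 := zeta + a4; have c3_ge0 : 0 <= c3 by rewrite addr_ge0.
have c3' : 0 <= 2 * c3 by rewrite mulr_ge0.
have as_ge0 : 0 <= alpha / s by rewrite divr_ge0 // ltW.
exists (1 + 2 * c3)^-1, (alpha / s * (cub + 2 * c3 * sm + 2 * c3 * cub)).
have d0 : 0 < 1 + 2 * c3 by rewrite ltr_wpDr // mulr_ge0.
split; [by rewrite invr_gt0| |].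
  exact: mulr_ge0 as_ge0
    (addr_ge0 (addr_ge0 cub_ge0 (mulr_ge0 c3' sm_ge0)) (mulr_ge0 c3' cub_ge0)).
move=> K E e V S [fK Ja] e0 ed Ee VE SE.
have V_le := value_le mu_gt0 X0_ge fK VE Ja.
have sK := feasible_stable fK.
have ed2 : e * (1 + 2 * c3) <= 1 by rewrite -ler_pdivlMr // div1r.
have ec0 : 0 <= e * c3 by rewrite mulr_ge0 // ltW.
have e1 : e <= 1 by lra.
have ec : e * c3 <= 2^-1 by lra.
have ea4 : a4 * e ^+ 2 <= a4 * e by rewrite ler_wpM2l // expr2 ler_piMr // ltW.
have dr : drift p s b c r e <= e * c3 by rewrite /drift /c3; lra.
have dr1 : drift p s b c r e < 1 by lra.
have fK' : feas (K + E).
  exact: (perturbed_feasible Q_psd Rw_psd s_gt0 r_ge0 p_ge0 Q_ge Rw_le B_le C_le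
    zeta_ge0 sK VE V_le e0 Ee dr1).
split=> //; have [V' V'E] := feasible_value fK'.
have [S' S'E pS'] := feasible_correlation fK'.
have pS : psd S by exact: correlation_psd fK SE X0_psd.
have cost_le := perturbed_cost_le Q_psd Rw_psd X0_psd s_gt0 r_ge0 p_ge0 Q_ge
  Rw_le B_le C_le zeta_ge0 sK VE V_le e0 Ee dr1 V'E.
have := cost_remainder Q_psd Rw_psd X0_psd s_gt0 b_gt0 c_gt0 r_ge0 p_ge0 Q_ge
  Rw_le B_le C_le zeta_ge0 sK VE V_le e0 Ee pS pS' SE S'E V'E.
have trS := trace_correlation_le Rw_psd pS' Q_ge V'E S'E.
rewrite -(JE fK VE) -(JE fK' V'E) in cost_le trS *.
move/le_trans; apply.
have trS2 : \tr S' <= alpha / s * (1 + 2 * (e * c3)).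
  rewrite mulrAC ler_pdivlMr // mulrC; apply: le_trans trS _.
  have J0 := cost_ge0 fK'.
  have : (1 - e * c3) * J (K + E) <= alpha.
    apply: le_trans (le_trans cost_le Ja); rewrite ler_wpM2r //; lra.
  move=> H; have x12 : 0 <= 1 + 2 * (e * c3) by lra.
  rewrite [leRHS]mulrC; apply: le_trans (ler_wpM2l x12 H).
  have : 0 <= e * c3 * (1 - 2 * (e * c3)) * J (K + E).
    by apply: mulr_ge0 => //; apply: mulr_ge0 => //; lra.
  by lra.
have q0 : 0 <= sm * e ^+ 2 + cub * e ^+ 3.
  by rewrite addr_ge0 // mulr_ge0 // exprn_ge0 // ltW.
apply: le_trans (ler_wpM2l q0 trS2) _.
rewrite -subr_ge0 (_ : _ - _ = alpha / s * (2 * c3 * cub) * (e ^+ 3 * (1 - e))); last by ring.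
have e3 : 0 <= e ^+ 3 * (1 - e) by rewrite mulr_ge0 ?exprn_ge0 ?subr_ge0 // (ltW e0).
exact: mulr_ge0 (mulr_ge0 as_ge0 (mulr_ge0 c3' cub_ge0)) e3.
Qed.

Lemma gradientE K V S : sub K -> value K V -> corr K S ->
  gradient J K = cost_gradient A B C Rw K V S.
Proof.
move=> subK VE SE.
have [delta [kappa [delta0 kappa0 hJ]]] := sublevel_expansion (ex_intro _ K subK).
apply: (@gradient_unique _ _ _ J K _ (`|sm * alpha / s| + kappa + 1) (Num.min delta 1)).
- by rewrite lt_min delta0 ltr01.
- by rewrite ltr_wpDl // addr_ge0.
move=> E e e0; rewrite le_min => /andP[ed e1] Ee.
have [_ H] := hJ K E e V S subK e0 ed Ee VE SE.
apply: le_trans H _.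
have e3 : e ^+ 3 <= e ^+ 2 by rewrite exprS ler_piMl // exprn_ge0 // ltW.
have h1 : kappa * e ^+ 3 <= kappa * e ^+ 2 by rewrite ler_wpM2l.
have h2 : sm * alpha / s * e ^+ 2 <= `|sm * alpha / s| * e ^+ 2.
  by rewrite ler_wpM2r ?sqr_ge0 // ler_norm.
apply: (le_trans (lerD h2 h1)); rewrite -mulrDl.
by rewrite ler_wpM2r ?sqr_ge0 // lerDl.
Qed.

Local Notation lip := (2 * (sm * alpha / s)).

(** The hypothesis on D says that the step is at most 1 / L in the direction of
    descent, so segment_descent applies to t |-> J (K + t D). *)
Lemma descent_step K D : sub K -> 0 < lip ->
  inner (gradient J K) D <= - (lip * inner D D) ->
  sub (K + D) /\ J (K + D) <= J K + inner (gradient J K) D + lip / 2 * inner D D.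
Proof.
move=> subK lip0 hD.
have [->|D0] := eqVneq D 0; first by rewrite !inner0r addr0 mulr0 !addr0.
have D1 : 0 < inner D D by rewrite inner_gt0.
pose g := frobenius_norm D; have g0 : 0 < g by rewrite /g frobenius_normE sqrtr_gt0.
have gg : inner D D = g ^+ 2 by rewrite sqr_frobenius_norm.
have [delta [kappa [delta0 kappa0 hJ]]] := sublevel_expansion (ex_intro _ K subK).
pose phi t := J (K + t *: D); pose psi t := inner (gradient J (K + t *: D)) D.
have expand u t : 0 < `|t - u| -> `|t - u| <= delta / g -> sub (K + u *: D) ->
    feas (K + t *: D) /\ `|phi t - phi u - psi u * (t - u)| <=
      lip * inner D D / 2 * (t - u) ^+ 2 + kappa * g ^+ 3 * `|t - u| ^+ 3.
  move=> tu0 tud subu.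
  have KE : K + t *: D = (K + u *: D) + (t - u) *: D.
    by rewrite scalerBl -addrA [u *: D + _]addrC subrK.
  have [V VE] := feasible_value (proj1 subu).
  have [S SE pS] := feasible_correlation (proj1 subu).
  have [|||f H] := hJ (K + u *: D) ((t - u) *: D) (`|t - u| * g) V S subu _ _ _ VE SE.
  - by rewrite mulr_gt0.
  - by rewrite -ler_pdivlMr.
  - by rewrite innerZl innerZr gg exprMn real_normK ?num_real // mulrA expr2.
  rewrite KE; split => //; rewrite /phi /psi KE (gradientE subu VE SE).
  rewrite innerZr in H; rewrite [inner _ D * _]mulrC; apply: le_trans H _.
  rewrite !exprMn real_normK ?num_real // gg le_eqVlt; apply/orP; left; apply/eqP.
  by field; rewrite lt0r_neq0.
have phi0 : phi 0 = J K by rewrite /phi scale0r addr0.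
have phi1 : phi 1 = J (K + D) by rewrite /phi scale1r.
have psi0 : psi 0 = inner (gradient J K) D by rewrite /psi scale0r addr0.
have sub_phi t : feas (K + t *: D) -> phi t <= alpha -> sub (K + t *: D) by split.
clearbody phi psi.
have := @segment_descent _ phi psi (fun t => feas (K + t *: D)) alpha
  (lip * inner D D) (kappa * g ^+ 3) (delta / g).
case.
- by rewrite mulr_gt0.
- by rewrite mulr_ge0 // exprn_ge0 // ltW.
- by rewrite divr_gt0.
- move=> u t u0 ut t1 tu fu au.
  have tu0 : 0 < t - u by rewrite subr_gt0.
  have := expand u t; rewrite (gtr0_norm tu0) => /(_ tu0 tu (sub_phi _ fu au)) [ft].
  by rewrite ler_norml => /andP[_ H]; split => //; lra.
- move=> u t u0 ut t1 tu fu au ft at_.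
  have tu0 : 0 < t - u by rewrite subr_gt0.
  have := expand t u; rewrite distrC (gtr0_norm tu0) => /(_ tu0 tu (sub_phi _ ft at_)) [_].
  rewrite ler_norml => /andP[_ H].
  have -> : (t - u) ^+ 2 = (u - t) ^+ 2 by ring.
  by lra.
- by rewrite /= scale0r addr0; case: subK.
- by rewrite phi0; case: subK.
- by rewrite psi0.
rewrite scale1r phi0 phi1 psi0 => f1 H.
have lD : 0 < lip * inner D D by rewrite mulr_gt0.
have H' : J (K + D) <= J K + inner (gradient J K) D + lip / 2 * inner D D.
  by apply: le_trans H _; rewrite lerD2l mulrAC.
split => //; split => //; have [_ Ja] := subK; apply: le_trans H' _.
rewrite -addrA; apply: le_trans Ja; rewrite gerDl mulrAC.
by apply: le_trans (lerD hD (lexx _)) _; lra.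
Qed.

Lemma gradient_step K eta t : sub K -> 0 < lip -> 0 < eta -> eta * lip <= 1 ->
  0 <= t <= 1 ->
  sub (K - (t * eta) *: gradient J K) /\
  J (K - (t * eta) *: gradient J K) <=
    J K - t * eta / 2 * inner (gradient J K) (gradient J K).
Proof.
move=> subK lip0 eta0 etal /andP[t0 t1]; set G := gradient J K.
have GG := inner_ge0 G.
have te : 0 <= t * eta by rewrite mulr_ge0 // ltW.
have tel : t * eta * lip <= 1.
  by rewrite -mulrA; apply: le_trans etal; rewrite ler_piMl // mulr_ge0 // ltW.
have key : lip * (t * eta) ^+ 2 * inner G G <= t * eta * inner G G.
  rewrite ler_wpM2r //; move: tel te; set h := t * eta; set l := lip => hl h0.
  by rewrite [l * _](_ : _ = h * l * h); [rewrite ler_piMl | ring].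
rewrite -scaleNr; have [|subD JD] := descent_step (D := (- (t * eta)) *: G) subK lip0.
  rewrite -/G !innerZr innerZl mulNr lerN2; apply: le_trans key.
  by rewrite le_eqVlt; apply/orP; left; apply/eqP; ring.
split => //; apply: le_trans JD _; rewrite -/G !innerZr innerZl.
by move: key GG; set N := inner G G; set h := t * eta; set l := lip; move=> *; lra.
Qed.

End SublevelSet.

(** The cost difference is exact and quadratic in Ks - K, with second-order part
    at least sR |z|^2 where z = (Ks - K) C x; completing the square bounds
    J K - J Ks by tr (a Ss a^T) / sR, where a is the advantage matrix. The gradient
    is 2 a S C^T, and both S >= mu and C are bounded below. *)
Lemma gradient_dominance (mu sC sR nS : R) K Ks V S Ss :
  0 < mu -> 0 < sC -> 0 < sR -> 0 <= nS ->
  (forall x : 'cV_n, mu * inner x x <= qform X0 x) ->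
  (forall Z : 'M[R]_(n, m), sC ^+ 2 * inner Z Z <= inner (C *m Z) (C *m Z)) ->
  (forall x : 'cV_m, sR * inner x x <= qform Rw x) ->
  (forall x : 'cV_n, qform Ss x <= nS * inner x x) ->
  feas K -> feas Ks -> value K V -> corr K S -> corr Ks Ss ->
  J K - J Ks <= nS / (4 * mu ^+ 2 * sC ^+ 2 * sR) *
    inner (cost_gradient A B C Rw K V S) (cost_gradient A B C Rw K V S).
Proof.
move=> mu0 sC0 sR0 nS0 X0_ge C_ge Rw_ge Ss_le fK fKs VE SE SsE.
set G := cost_gradient A B C Rw K V S.
have pS := correlation_psd fK SE X0_psd; have pSs := correlation_psd fKs SsE X0_psd.
have pV := lyapunov_psd (feasible_stable fK) VE (running_weight_psd C Q_psd Rw_psd K).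
have [sV V0] := pV; have [Vs VsE] := feasible_value fKs.
pose a := advantage A B C Rw K V; pose E := Ks - K.
have KE : K + E = Ks by rewrite addrC subrK.
have := @cost_difference _ _ _ _ A B C Q Rw X0 Rw_psd K E V Vs Ss VE sV pSs.
rewrite KE => /(_ VsE SsE); rewrite -(JE fK VE) -(JE fKs VsE) => diff.
have lower : \tr ((- sR^-1) *: (a^T *m a) *m Ss) <= J Ks - J K.
  rewrite diff -mxtraceD -mulmxDl; apply: trace_psd_le => // x.
  rewrite qformZ qform_gram qformD qform_second_order.
  set z := E *m C *m x.
  rewrite qform_first_order_advantage -/z -/a.
  have h1 : 0 <= qform V (B *m z) by exact: qform_psd_ge0.
  have h2 : sR * inner z z <= qform Rw z by exact: Rw_ge.
  have := psd_young (-1 *: z) (a *m x) (psd1 m) sR0.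
  by rewrite mul1mx !qform1 !innerZl innerZr; lra.
have upper : \tr (a^T *m a *m Ss) <= nS * inner a a.
  rewrite mxtrace_mulC -[inner a a]/(\tr _) -mxtraceZ -mul_scalar_mx.
  apply: trace_psd_le => [|x]; first by rewrite -{2}[a]trmxK; exact: psd_rank1.
  by rewrite -scalemx1 qformZ qform1; exact: Ss_le.
have G_ge : 4 * mu ^+ 2 * sC ^+ 2 * inner a a <= inner G G.
  have S_ge q (Z : 'M[R]_(n, q)) : mu * inner Z Z <= qform S Z.
    rewrite -qform1 -qformZ; apply: qform_le => x; rewrite qformZ qform1.
    apply: le_trans (X0_ge x) _.
    have -> : qform S x = qform X0 x + qform S ((closed_loop A B C K)^T *m x).
      by rewrite {1}SE qformD -qform_congr trmxK.
    by rewrite lerDl; exact: qform_psd_ge0.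
  have SZ : mu ^+ 2 * inner a^T a^T <= inner (S *m a^T) (S *m a^T).
    have := S_ge _ a^T; have := psd_young a^T (S *m a^T) (psd1 n) mu0.
    rewrite mul1mx !qform1 -/(qform S a^T) => h1 h2.
    have : mu * inner a^T a^T <= (mu)^-1 * inner (S *m a^T) (S *m a^T) by lra.
    by rewrite -(ler_pM2l mu0) mulVKf ?lt0r_neq0 // mulrA expr2.
  rewrite /G /cost_gradient innerZl innerZr -/a -[inner (_ *m C^T) _]inner_tr 2!trmx_mul trmxK.
  have [sS _] := pS; rewrite sS.
  have := C_ge (S *m a^T); rewrite inner_tr in SZ.
  have : sC ^+ 2 * (mu ^+ 2 * inner a a) <= sC ^+ 2 * inner (S *m a^T) (S *m a^T).
    by rewrite ler_wpM2l ?sqr_ge0.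
  by move=> *; lra.
rewrite -scalemxAl mxtraceZ in lower.
have h : J K - J Ks <= sR^-1 * (nS * inner a a).
  have := ler_wpM2l (ltW (_ : 0 < sR^-1)) upper.
  by rewrite invr_gt0 => /(_ sR0) ?; lra.
apply: le_trans h _.
have den : 0 < 4 * mu ^+ 2 * sC ^+ 2 by rewrite !mulr_gt0 ?exprn_gt0.
rewrite [leLHS](_ : _ = nS / (4 * mu ^+ 2 * sC ^+ 2 * sR) *
  (4 * mu ^+ 2 * sC ^+ 2 * inner a a)); last first.
  by field; rewrite !lt0r_neq0.
apply: ler_wpM2l G_ge; rewrite divr_ge0 // ltW // mulr_gt0 //.
Qed.

End Descent.

(** * Convergence rates *)

Section Rates.
Context {R : realType}.

(** The constant L of the theorem, in terms of the expansion above. *)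
Lemma smoothnessE (p s b c r alpha : R) : 0 < s -> 0 < b -> 0 < c ->
  2 * c ^+ 2 * (r + b ^+ 2 * (1 + 2 * growth_factor p s b c r / (c * b)) * p) *
    (alpha / s) = 2 * (smoothness p s b c r * alpha / s).
Proof.
move=> s0 b0 c0; rewrite /smoothness; set z := growth_factor _ _ _ _ _.
by field; rewrite !lt0r_neq0.
Qed.

Lemma contraction_rateE (nS mu sC sR eta : R) :
  0 < mu -> 0 < sC -> 0 < sR -> 0 < eta ->
  2 * (nS / (4 * mu ^+ 2 * sC ^+ 2 * sR)) / eta =
  nS / (2 * eta * mu ^+ 2 * sC ^+ 2 * sR).
Proof. by move=> *; field; rewrite !lt0r_neq0. Qed.

(** Otherwise each of the first floor (x) + 1 steps, with x the claimed bound,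
    would decrease a by at least eta eps^2 / 2, and a would become negative. *)
Lemma small_gradient_index (a g : nat -> R) (eta eps : R) : 0 < eta -> 0 < eps ->
  (forall i, 0 <= a i) -> (forall i, 0 <= g i) ->
  (forall i, a i.+1 <= a i - eta / 2 * g i ^+ 2) ->
  exists i : nat, i%:R <= 2 * a 0%N / (eta * eps ^+ 2) /\ g i <= eps.
Proof.
move=> eta0 eps0 a0 g0 dec; apply: contrapT => none.
set x := 2 * a 0%N / (eta * eps ^+ 2) in none *.
have c0 : 0 < eta * eps ^+ 2 by rewrite mulr_gt0 // exprn_gt0.
have x0 : 0 <= x by rewrite divr_ge0 ?mulr_ge0 // ltW.
have big i : i%:R <= x -> eps ^+ 2 <= g i ^+ 2.
  move=> ix; rewrite ler_pXn2r ?nnegrE ?(ltW eps0) //.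
  by rewrite leNgt; apply/negP => gi; apply: none; exists i; split => //; exact: ltW.
have /andP[Nx xN] := Num.Theory.truncn_itv x0; set N := Num.truncn x in Nx xN.
have down k : (k <= N.+1)%N -> a k <= a 0%N - k%:R * (eta / 2 * eps ^+ 2).
  elim: k => [|k IH] kN; first by rewrite mul0r subr0.
  apply: le_trans (dec k) _; have := IH (ltnW kN).
  have kx : k%:R <= x by apply: le_trans Nx; rewrite ler_nat.
  have : eta / 2 * eps ^+ 2 <= eta / 2 * g k ^+ 2.
    by rewrite ler_wpM2l ?big // divr_ge0 // ltW.
  by rewrite -[k.+1%:R]natr1 mulrDl mul1r; lra.
have := down N.+1 (leqnn _); have := a0 N.+1.
have : x * (eta / 2 * eps ^+ 2) < N.+1%:R * (eta / 2 * eps ^+ 2).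
  by rewrite ltr_pM2r // mulr_gt0 ?divr_gt0 // exprn_gt0.
have -> : x * (eta / 2 * eps ^+ 2) = a 0%N.
  by rewrite /x; field; rewrite !lt0r_neq0.
by lra.
Qed.

(** The inequalities give e_(i+1) <= (1 - q) e_i with q = eta / (2 D), and
    1 - q <= exp (- q). If e_0 <= eps the logarithm carries no information and
    monotonicity suffices. *)
Lemma linear_rate (e g : nat -> R) (eta eps D : R) (N : nat) :
  0 < eta -> 0 < eps -> 0 <= D ->
  (forall i, 0 <= e i) -> (forall i, 0 <= g i) ->
  (forall i, e i.+1 <= e i - eta / 2 * g i) -> (forall i, e i <= D * g i) ->
  2 * D / eta * ln (e 0%N / eps) <= N%:R -> e N <= eps.
Proof.
move=> eta0 eps0 D0 e0 g0 dec dom hN.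
have [De|Dn] := eqVneq D 0.
  by apply: le_trans (dom N) _; rewrite De mul0r ltW.
have Dp : 0 < D by rewrite lt_def Dn.
have [small|large] := leP (e 0%N) eps.
  elim: N {hN} => // N IH; apply: le_trans (dec N) _; apply: le_trans IH.
  by rewrite gerBl mulr_ge0 // divr_ge0 // ltW.
pose q := eta / (2 * D); have q0 : 0 < q by rewrite divr_gt0 // mulr_gt0.
have step i : e i.+1 <= expR (- q) * e i.
  apply: le_trans (_ : (1 + - q) * e i <= _); last by rewrite ler_wpM2r // expR_ge1Dx.
  apply: le_trans (dec i) _; rewrite mulrDl mul1r lerD2l mulNr lerN2.
  rewrite /q mulrAC ler_pdivrMr ?mulr_gt0 //.
  have : eta * e i <= eta * (D * g i) by rewrite ler_wpM2l // ltW.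
  by lra.
have geo k : e k <= expR (- (q * k%:R)) * e 0%N.
  elim: k => [|k IH]; first by rewrite mulr0 oppr0 expR0 mul1r.
  apply: le_trans (step k) _.
  have -> : - (q * k.+1%:R) = - q - q * k%:R by rewrite -[k.+1%:R]natr1; ring.
  by rewrite expRD -mulrA ler_wpM2l // expR_ge0.
apply: le_trans (geo N) _.
have e00 : 0 < e 0%N by apply: lt_trans large.
have r0 : 0 < e 0%N / eps by rewrite divr_gt0.
have : ln (e 0%N / eps) <= q * N%:R.
  rewrite -(ler_pM2l (_ : 0 < 2 * D / eta)) ?divr_gt0 ?mulr_gt0 //.
  apply: le_trans hN _; rewrite le_eqVlt; apply/orP; left; apply/eqP.
  by rewrite /q; field; rewrite !lt0r_neq0.
move=> lnq; have H : expR (- (q * N%:R)) <= (e 0%N / eps)^-1.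
  by rewrite -(lnK (_ : e 0%N / eps \is Num.pos)) ?posrE // -expRN ler_expR lerN2.
apply: le_trans (ler_wpM2r (ltW e00) H) _.
by rewrite invf_div divfK ?lt0r_neq0.
Qed.

End Rates.

(** * Gradient descent for static output feedback *)

Theorem theorem1 (R : realType) (dsp : measure_display)
  (T : measurableType dsp) (P : probability T R) (n m d : nat)
  (x0 : 'I_n -> {RV P >-> R})
  (A : 'M[R]_n) (B : 'M[R]_(n, m)) (C : 'M[R]_(d, n))
  (Q : 'M[R]_n) (Rw : 'M[R]_m) (K0 : 'M[R]_(m, d)) (alpha eta : R)
  (x0_moment : forall i, P.-integrable setT (fun w => (x0 i w ^+ 2)%:E))
  (C_full_row_rank : \rank C = d)
  (Q_posdef : sym_posdef Q) (Rw_posdef : sym_posdef Rw)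
  (K0_feasible : feasible A B C K0) :
  let J := output_cost x0 A B C Q Rw in
  let mu := sigma_min (second_moment x0) in
  let nB := spectral_norm B in
  let nC := spectral_norm C in
  let nR := spectral_norm Rw in
  let zeta1 := (sigma_min Q)^-1 *
    ((1 + nC ^+ 2 * nB ^+ 2) * (alpha / mu) + nC ^+ 2 * nR) - 1 in
  let L := 2 * nC ^+ 2 *
    (nR + nB ^+ 2 * (1 + 2 * zeta1 / (nC * nB)) * (alpha / mu)) *
    (alpha / sigma_min Q) in
  let K := gradient_descent x0 A B C Q Rw eta K0 in
  let Jsopt := optimal_state_feedback_cost x0 A B Q Rw in
  J K0 = alpha -> 0 < mu -> B != 0 -> 0 < eta -> eta <= 1 / L ->
  [/\ forall i, feasible A B C (K i) /\ J (K i.+1) <= J (K i),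
      forall eps : R, 0 < eps ->
        exists i : nat, i%:R <= 2 * alpha / (eta * eps ^+ 2) /\
          frobenius_norm (gradient J (K i)) <= eps,
      forall (i : nat) (s : R), 0 <= s <= 1 ->
        sublevel x0 A B C Q Rw alpha ((1 - s) *: K i + s *: K i.+1) &
      d = n -> \rank C = n ->
        forall Kstar, global_minimizer x0 A B C Q Rw Kstar ->
        forall (epsJ : R) (N : nat), 0 < epsJ ->
          spectral_norm (state_correlation x0 A B C Kstar) /
            (2 * eta * mu ^+ 2 * sigma_min C ^+ 2 * sigma_min Rw) *
            ln ((J K0 - Jsopt) / epsJ) <= N%:R ->
          J (K N) - Jsopt <= epsJ].
Proof.
move=> J mu nB nC nR zeta1 L K Jsopt JK0 mu0 B0 eta0 etaL.
have Qp := sym_posdef_psd Q_posdef; have Rp := sym_posdef_psd Rw_posdef.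
have Xp := second_moment_psd x0_moment.
have JE (K' : 'M[R]_(m, d)) V : feasible A B C K' -> value_matrix A B C Q Rw K' V ->
    J K' = \tr (V *m second_moment x0).
  by move=> /feasible_stable sM VE; exact: (quadratic_costE x0_moment sM VE).
have n0 : (0 < n)%N.
  rewrite lt0n; apply: contraNneq B0 => n0; apply/eqP/matrixP => - [i lt_in].
  by have := lt_in; rewrite {1}n0.
have m0 : (0 < m)%N.
  rewrite lt0n; apply: contraNneq B0 => m0; apply/eqP/matrixP => i [j lt_jm].
  by have := lt_jm; rewrite {1}m0.
(* A positive step size below 1 / L forces L > 0, because 1 / 0 = 0 here. Hence
   no factor of L vanishes, which excludes all degenerate cases. *)
have L0 : 0 < L by have := lt_le_trans eta0 etaL; rewrite div1r invr_gt0.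
have [X LX] : exists X, L = X * (alpha / sigma_min Q) by eexists.
have nB0 : 0 < nB by exact: spectral_norm_gt0.
have nC0 : 0 < nC.
  rewrite lt_def spectral_norm_ge0 andbT; apply/eqP => nC0.
  by move: L0; rewrite /L nC0 expr0n mulr0 !mul0r ltxx.
have sQ0 : 0 < sigma_min Q.
  rewrite lt_def sigma_min_ge0 andbT; apply/eqP => sQ0.
  by move: L0; rewrite LX sQ0 invr0 !mulr0 ltxx.
have alpha0 : 0 < alpha.
  rewrite lt_def -{2}JK0 (cost_ge0 Qp Rp Xp JE K0_feasible) andbT; apply/eqP => a0.
  by move: L0; rewrite LX a0 mul0r mulr0 ltxx.
have X0_ge (x : 'cV_n) : mu * inner x x <= qform (second_moment x0) x.
  exact: sigma_min_qform_le.
have Q_ge (x : 'cV_n) : sigma_min Q * inner x x <= qform Q x by exact: sigma_min_qform_le.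
have Rw_le (x : 'cV_m) : qform Rw x <= nR * inner x x by exact: qform_le_spectral_norm.
have B_le (x : 'cV_m) : inner (B *m x) (B *m x) <= nB ^+ 2 * inner x x.
  exact: spectral_norm_mul_le.
have C_le (x : 'cV_n) : inner (C *m x) (C *m x) <= nC ^+ 2 * inner x x.
  exact: spectral_norm_mul_le.
have nR0 : 0 <= nR by exact: spectral_norm_ge0.
have LE : L = 2 * (smoothness (alpha / mu) (sigma_min Q) nB nC nR * alpha / sigma_min Q).
  exact: smoothnessE.
have etaL1 : eta * L <= 1 by move: etaL; rewrite ler_pdivlMr.
rewrite LE in L0 etaL1.
(* From here on only the bounds just proved on these constants matter. *)
clearbody mu nB nC nR.
pose sub := in_sublevel A B C J alpha.
have step K' t : sub K' -> 0 <= t <= 1 -> sub (K' - (t * eta) *: gradient J K') /\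
    J (K' - (t * eta) *: gradient J K') <=
    J K' - t * eta / 2 * inner (gradient J K') (gradient J K').
  move=> subK' t01.
  exact: (gradient_step Qp Rp Xp JE n0 mu0 sQ0 nB0 nC0 nR0 alpha0 X0_ge Q_ge
    Rw_le B_le C_le subK' L0 eta0 etaL1 t01).
have K_next i : K i.+1 = K i - eta *: gradient J (K i) by [].
have subK i : sub (K i).
  elim: i => [|i IH]; first by split => //; rewrite /K /= -JK0.
  have [|+ _] := step _ 1 IH; first by rewrite ler01 lexx.
  by rewrite mul1r -K_next.
have descent i : J (K i.+1) <= J (K i) - eta / 2 * frobenius_norm (gradient J (K i)) ^+ 2.
  have [|_] := step _ 1 (subK i); first by rewrite ler01 lexx.
  by rewrite mul1r -K_next sqr_frobenius_norm.
have J_ge0 i : 0 <= J (K i) by exact: (cost_ge0 Qp Rp Xp JE (proj1 (subK i))).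
split.
- move=> i; split; first by case: (subK i).
  apply: le_trans (descent i) _; rewrite gerBl.
  by rewrite mulr_ge0 ?sqr_ge0 // divr_ge0 // ltW.
- move=> eps eps0; rewrite -JK0.
  exact: (small_gradient_index eta0 eps0 J_ge0 (fun i => frobenius_norm_ge0 _) descent).
- move=> i s s01; have [H _] := step _ s (subK i) s01.
  rewrite K_next scalerBr addrA -scalerDl subrK scale1r scalerA.
  exact: H.
- move=> dn; subst d => rC Ks [fKs minKs] eps N eps0.
  have uC : C \in unitmx by rewrite -row_free_unit /row_free rC.
  have sC0 := sigma_min_gt0 n0 uC.
  have sR0 := sigma_min_gt0 m0 (sym_posdef_unit Rw_posdef).
  (* For invertible C every state feedback F is the output feedback F C^-1. *)
  have outE (K' : 'M[R]_(m, n)) : state_feedback_cost x0 A B Q Rw (K' *m C) = J K'.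
    by rewrite /J /output_cost /state_feedback_cost trmx_mul !mulmxA.
  have JsE : Jsopt = J Ks.
    rewrite /Jsopt /optimal_state_feedback_cost; set E := (X in inf X).
    have inE (K' : 'M[R]_(m, n)) : feasible A B C K' -> E (J K').
      by move=> fK'; exists (K' *m C); [rewrite /= mulmxA; exact: fK' | exact: outE].
    have E_lb : lbound E (J Ks).
      move=> _ [F fF <-]; rewrite -[F](mulmxKV uC) outE; apply: minKs.
      by rewrite /feasible -[B *m _ *m C]mulmxA (mulmxKV uC); exact: fF.
    apply/eqP; rewrite eq_le; apply/andP; split.
      by apply: ge_inf; [exists (J Ks) | exact: inE].
    by apply: lb_le_inf; [exists (J Ks); exact: inE | exact: E_lb].
  have [Ss SsE pSs] := feasible_correlation Xp fKs.
  rewrite (state_correlationE x0_moment fKs SsE) JsE => hN.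
  set nS := spectral_norm Ss in hN.
  have nS0 : 0 <= nS by exact: spectral_norm_ge0.
  have C_ge (Z : 'M[R]_(n, m)) :
    sigma_min C ^+ 2 * inner Z Z <= inner (C *m Z) (C *m Z) by exact: sigma_min_mul_le.
  have Rw_ge (x : 'cV_m) : sigma_min Rw * inner x x <= qform Rw x by exact: sigma_min_qform_le.
  have Ss_le (x : 'cV_n) : qform Ss x <= nS * inner x x by exact: qform_le_spectral_norm.
  pose D := nS / (4 * mu ^+ 2 * sigma_min C ^+ 2 * sigma_min Rw).
  apply: (@linear_rate _ (fun i => J (K i) - J Ks)
    (fun i => frobenius_norm (gradient J (K i)) ^+ 2) eta eps D) => //.
  + apply: divr_ge0 nS0 (ltW _).
    have four : 0 < 4 :> R by [].
    exact: mulr_gt0 (mulr_gt0 (mulr_gt0 four (exprn_gt0 2 mu0)) (exprn_gt0 2 sC0)) sR0.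
  + by move=> i; rewrite subr_ge0; apply: minKs; case: (subK i).
  + by move=> i; rewrite sqr_ge0.
  + by move=> i; rewrite addrAC lerD2r; exact: descent.
  + move=> i; have [V VE] := feasible_value Q Rw (proj1 (subK i)).
    have [S SE pS] := feasible_correlation Xp (proj1 (subK i)).
    rewrite sqr_frobenius_norm.
    rewrite (gradientE Qp Rp Xp JE n0 mu0 sQ0 nB0 nC0 nR0 alpha0 X0_ge Q_ge
      Rw_le B_le C_le (subK i) VE SE).
    exact: (gradient_dominance Qp Rp Xp JE mu0 sC0 sR0 nS0 X0_ge C_ge Rw_ge Ss_le
      (proj1 (subK i)) fKs VE SE SsE).
  + by rewrite /D (contraction_rateE nS mu0 sC0 sR0 eta0).
Qed.
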